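(* Let $X$ be the self-adjoint multiplication operator $Xf(x)=x\,f(x)$ on $L^2(\mathbb{R},\mathbb{C})$, which is an $\mathcal{N}(0,1/2)$-distributed quantum random variable in the state $\Phi(x)=\pi^{-1/4}e^{-x^2/2}$. Then for $t\in\mathbb{R}$ the characteristic function of $X^3$ is $$\langle e^{itX^3}\rangle=\begin{cases}\dfrac{2}{3|t|\sqrt{3\pi}}\,e^{\frac{2}{27t^2}}\,K_{1/3}\!\left(\dfrac{2}{27t^2}\right), & \text{if } t\neq 0,\\[2mm] 1, & \text{if } t=0,\end{cases}$$ where $K_\nu(z)$ denotes the modified Bessel function of the second kind.
   Context: $L^2(\mathbb{R},\mathbb{C})$ carries the inner product $\langle f,g\rangle=\int_{\mathbb{R}}\overline{f(x)}g(x)\,dx$. The unbounded self-adjoint operator $X$, $Xf(x)=x f(x)$, has domain $\{f\in L^2(\mathbb{R},\mathbb{C}):\int_{\mathbb{R}}x^2|f(x)|^2\,dx<\infty\}$. The function $\Phi(x)=\pi^{-1/4}e^{-x^2/2}$ is a unit vector in $L^2(\mathbb{R},\mathbb{C})$. For a self-adjoint operator $A$ on $L^2(\mathbb{R},\mathbb{C})$, its characteristic function (in the state $\Phi$) is $\langle e^{itA}\rangle=\langle\Phi,e^{itA}\Phi\rangle$, $t\in\mathbb{R}$; via Bochner's theorem, $A$ is identified with the classical random variable having this characteristic function. The operators $X^3$ and $e^{itX^3}$ are defined by the spectral theorem (functional calculus) for $X$. One has $\langle e^{itX}\rangle=e^{-t^2/4}$, i.e. $X\sim\mathcal{N}(0,1/2)$,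 where $\mathcal{N}(\mu,\sigma^2)$ is the Gaussian distribution with mean $\mu$ and variance $\sigma^2$. *)

(* Defs.v *)
From HB Require Import structures.
From mathcomp Require Import all_boot all_order all_algebra.
From mathcomp Require Import complex.
From mathcomp Require Import all_classical all_reals all_analysis.

Set Implicit Arguments.
Unset Strict Implicit.
Unset Printing Implicit Defensive.

Import Order.TTheory GRing.Theory Num.Theory.
Import numFieldNormedType.Exports.

Local Open Scope classical_set_scope.
Local Open Scope ring_scope.
Local Open Scope complex_scope.

Section ComplexValued.
Context {R : realType}.
Implicit Types (z : R[i]) (f g : R -> R[i]).

Definition sqmodulus z : R := complex.Re z ^+ 2 + complex.Im z ^+ 2.

Definition expi (x : R) : R[i] := cos x +i* sin x.

Definition cintegral (mu : set (measurableTypeR R) -> \bar R) f : R[i] :=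
  fine (\int[mu]_x (complex.Re (f x))%:E)
  +i* fine (\int[mu]_x (complex.Im (f x))%:E).

End ComplexValued.

(* Elements of L^2(R, C) are represented by square-integrable functions, and
   equality in L^2 by equality almost everywhere. *)
Section L2space.
Context {R : realType}.
Implicit Types (f g : R -> R[i]).

Definition aeeq f g : Prop := \forall x \ae @lebesgue_measure R, f x = g x.

Definition sqnorm f : \bar R :=
  (\int[@lebesgue_measure R]_x (sqmodulus (f x))%:E)%E.

Definition L2 f : Prop :=
  [/\ measurable_fun [set: measurableTypeR R] (fun x => complex.Re (f x)),
      measurable_fun [set: measurableTypeR R] (fun x => complex.Im (f x))
    & (sqnorm f < +oo)%E].

Definition inner f g : R[i] :=
  cintegral (@lebesgue_measure R) (fun x => conjc (f x) * g x).

End L2space.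

(* A (possibly unbounded) linear operator in L^2(R, C): the value [app A f] is
   only meaningful for [f] in [dom A]. *)
Record operator (R : realType) := Operator {
  dom : set (R -> R[i]);
  app :> (R -> R[i]) -> (R -> R[i])
}.

Section Operators.
Context {R : realType}.
Implicit Types (f g : R -> R[i]) (A B : operator R) (phi : R -> R[i]).

Record linear_operator A : Prop := LinearOperator {
  dom_L2 : forall f, dom A f -> L2 f;
  app_L2 : forall f, dom A f -> L2 (A f);
  dom_aeeq : forall f g, dom A f -> L2 g -> aeeq f g -> dom A g;
  app_aeeq : forall f g, dom A f -> dom A g -> aeeq f g -> aeeq (A f) (A g);
  dom_zero : dom A (fun=> 0);
  dom_linear : forall (a : R[i]) f g,
    dom A f -> dom A g -> dom A (fun x => a * f x + g x);
  app_linear : forall (a : R[i]) f g,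
    dom A f -> dom A g ->
    aeeq (A (fun x => a * f x + g x)) (fun x => a * A f x + A g x)
}.

Definition orthogonal_projection (P : (R -> R[i]) -> (R -> R[i])) : Prop :=
  [/\ linear_operator (Operator (@L2 R) P),
      (forall f, L2 f -> aeeq (P (P f)) (P f))
    & (forall f g, L2 f -> L2 g -> inner (P f) g = inner f (P g))].

Record projection_valued_measure
    (E : set R -> (R -> R[i]) -> (R -> R[i])) : Prop :=
  ProjectionValuedMeasure {
  pvm_proj : forall S : set (measurableTypeR R),
    measurable S -> orthogonal_projection (E S);
  pvm_set0 : forall f, L2 f -> aeeq (E set0 f) (fun=> 0);
  pvm_setT : forall f, L2 f -> aeeq (E [set: R] f) f;
  pvm_setI : forall S T : set (measurableTypeR R),
    measurable S -> measurable T ->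
    forall f, L2 f -> aeeq (E (S `&` T) f) (E S (E T f));
  pvm_bigcup : forall F : nat -> set (measurableTypeR R),
    (forall n, measurable (F n)) -> trivIset [set: nat] F ->
    forall f, L2 f ->
    sqnorm (fun x => E (\bigcup_n F n) f x - \sum_(i < n) E (F i) f x)
      @[n --> \oo] --> 0%E
}.

(* As [E S] is an orthogonal projection, ||E(S) f||^2 = <f, E(S) f>; written
   this way it is nonnegative also for non-measurable [S]. *)
Definition spectral_measure_at (E : set R -> (R -> R[i]) -> (R -> R[i])) f
  : set (measurableTypeR R) -> \bar R := fun S => sqnorm (E S f).

(* A is the integral of phi against E.  Since A is linear, its quadratic form
   <f, A f> determines it, by polarization. *)
Definition is_spectral_integral (E : set R -> (R -> R[i]) -> (R -> R[i]))
    phi A : Prop :=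
  [/\ linear_operator A,
      (forall f, dom A f <->
         L2 f /\
         (\int[spectral_measure_at E f]_x (sqmodulus (phi x))%:E < +oo)%E)
    & (forall f, dom A f ->
         inner f (A f) = cintegral (spectral_measure_at E f) phi)].

(* B = phi(A), for A self-adjoint: E is the spectral resolution of A. *)
Definition is_functional_calculus A phi B : Prop :=
  exists E, [/\ projection_valued_measure E,
                is_spectral_integral E (fun x => x%:C) A
              & is_spectral_integral E phi B].

Definition position : operator R :=
  Operator [set f : R -> R[i] | L2 f /\
             (\int[@lebesgue_measure R]_x (x ^+ 2 * sqmodulus (f x))%:E
                < +oo)%E]
           (fun f x => x%:C * f x).

Definition Phi (x : R) : R[i] := (pi `^ (- 4^-1) * expR (- (x ^+ 2) / 2))%:C.

End Operators.

Arguments position : clear implicits.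

Section Bessel.
Context {R : realType}.

Definition cosh (x : R) : R := (expR x + expR (- x)) / 2.

(* Modified Bessel function of the second kind, for z > 0 (this integral is
   DLMF 10.32.9). *)
Definition besselK (nu z : R) : R :=
  \int[@lebesgue_measure R]_(s in `[0, +oo[) (expR (- z * cosh s) * cosh (nu * s)).

End Bessel.

(* Main.v *)
Require Import Defs.
From HB Require Import structures.
From mathcomp Require Import all_boot all_order all_algebra.
From mathcomp Require Import complex.
From mathcomp Require Import all_classical all_reals all_analysis.
From mathcomp Require Import measurable_realfun simple_functions.
From mathcomp Require Import ring lra.

(** Two independent facts make up the proof.

    Spectral part. A functional calculus of the position operator [X] comes
    with some projection-valued measure [E] such that [X] is the integral of
    [x] against [E], and [E] has to be shown to consist of the multiplications
    by indicators ([cut]). That these do form a projection-valued measure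
    which integrates to [X] gives the existence of the calculus; uniqueness is
    the substance. Let [P = E I] with [I] a set inside [[c - r, c + r]]. The
    spectral measure of a sum of vectors in the ranges of [E I] and [E J] is
    the sum of their spectral measures when [I] and [J] are disjoint, so [X]
    has no matrix element between these ranges ([position_form_disjoint]);
    hence [X] maps the range of [P] to itself ([in_range_mulx]). On that range
    [- r <= X - c <= r] as quadratic forms, so that [X - c] is a contraction
    up to the factor [r] ([in_range_contraction]). By iteration, the integral
    of [(x - c)^(2k) |f|^2] is at most [r^(2k)] times that of [|f|^2] for
    every [k], which forces [f] to vanish outside [[c - r, c + r]]
    ([in_range_support]). It follows that [E] of a half-line is the
    multiplication by its indicator, hence that every spectral measure of [E]
    is [|f(x)|^2 dx] ([position_spectral_measure]). The characteristic
    function of [X^3] is therefore the integral of [expi (t * x ^+ 3)] against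
    the Gaussian density, and its imaginary part vanishes by parity.

    Analytic part.  For [t > 0] the integral of [e^(- x^2) cos (t x^3)] over
    [x >= 0] is the real part of that of the entire function
    [e^(i t z^3 - z^2)].  The half-line is deformed to the curve
    [z = (sqrt 3 sinh (s/3) + i (cosh (s/3) - 1)) / (3 t)], an arc of a
    hyperbola starting at [0], through the curves on which the imaginary part is
    multiplied by [l] in [[0, 1]].  The derivative in [l] of the integral over
    [0 <= s <= V] is a boundary term at [s = V] ([homotopy_difference]), which
    tends to [0] as [V] grows ([flux_le]).  On the final curve the exponent is
    the real number [2 / (27 t^2) * (1 - cosh s)], because
    [cosh s = 4 cosh (s/3)^3 - 3 cosh (s/3)], and the integrand becomes that of
    the Bessel function [K_(1/3)] ([cubic_gauss_besselK]). *)

Import Order.TTheory GRing.Theory Num.Theory.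
Import numFieldNormedType.Exports.

Local Open Scope classical_set_scope.
Local Open Scope ring_scope.
Local Open Scope complex_scope.

Set Implicit Arguments.
Unset Strict Implicit.
Unset Printing Implicit Defensive.

Local Notation Rez := complex.Re.
Local Notation Imz := complex.Im.
Local Notation leb := (@lebesgue_measure _).

(** * Square-integrable functions *)

Section SquareIntegrable.
Context {R : realType}.
Implicit Types (f g h : R -> R[i]) (S : set (measurableTypeR R)).

Local Notation mu := (@lebesgue_measure R).

Lemma ReD (z w : R[i]) : Rez (z + w) = Rez z + Rez w.
Proof. by case: z w => [a b] [c d]. Qed.
Lemma ImD (z w : R[i]) : Imz (z + w) = Imz z + Imz w.
Proof. by case: z w => [a b] [c d]. Qed.
Lemma ReM (z w : R[i]) : Rez (z * w) = Rez z * Rez w - Imz z * Imz w.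
Proof. by case: z w => [a b] [c d]. Qed.
Lemma ImM (z w : R[i]) : Imz (z * w) = Rez z * Imz w + Imz z * Rez w.
Proof. by case: z w => [a b] [c d]. Qed.

Lemma sqmodulus_ge0 (z : R[i]) : 0 <= sqmodulus z.
Proof. by rewrite /sqmodulus addr_ge0 ?sqr_ge0. Qed.

Lemma sqmodulus_eq0 (z : R[i]) : sqmodulus z = 0 -> z = 0.
Proof.
rewrite /sqmodulus; case: z => a b /= /eqP.
by rewrite paddr_eq0 ?sqr_ge0// !sqrf_eq0 => /andP[/eqP-> /eqP->].
Qed.

Definition cmeasurable f :=
  measurable_fun [set: measurableTypeR R] (fun x => Rez (f x)) /\
  measurable_fun [set: measurableTypeR R] (fun x => Imz (f x)).

Lemma L2_cmeasurable f : L2 f -> cmeasurable f.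
Proof. by case. Qed.

Lemma cmeasurableD f g : cmeasurable f -> cmeasurable g ->
  cmeasurable (fun x => f x + g x).
Proof.
move=> [mf1 mf2] [mg1 mg2]; split.
  by under eq_fun do rewrite ReD; exact: measurable_funD.
by under eq_fun do rewrite ImD; exact: measurable_funD.
Qed.

Lemma cmeasurableM f g : cmeasurable f -> cmeasurable g ->
  cmeasurable (fun x => f x * g x).
Proof.
move=> [mf1 mf2] [mg1 mg2]; split.
  under eq_fun do rewrite ReM; apply: measurable_funB; exact: measurable_funM.
under eq_fun do rewrite ImM; apply: measurable_funD; exact: measurable_funM.
Qed.

Lemma cmeasurable_real (u : R -> R) :
  measurable_fun [set: measurableTypeR R] u -> cmeasurable (fun x => (u x)%:C).
Proof. by move=> mu_; split => /=; [exact: mu_|exact: measurable_cst]. Qed.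

Lemma cmeasurable_cst (c : R[i]) : cmeasurable (fun=> c).
Proof. by split; exact: measurable_cst. Qed.

Lemma measurable_sqmodulus f : cmeasurable f ->
  measurable_fun [set: measurableTypeR R] (fun x => sqmodulus (f x)).
Proof.
by move=> [m1 m2]; apply: measurable_funD; exact: measurable_funX.
Qed.

Lemma measurable_dot f g : cmeasurable f -> cmeasurable g ->
  measurable_fun [set: measurableTypeR R]
    (fun x => Rez (f x) * Rez (g x) + Imz (f x) * Imz (g x)).
Proof.
by move=> [? ?] [? ?]; apply: measurable_funD; exact: measurable_funM.
Qed.

Lemma L2_integrable f : L2 f ->
  mu.-integrable [set: measurableTypeR R] (fun x => (sqmodulus (f x))%:E).
Proof.
move=> [m1 m2 foo]; apply/integrableP; split.
  by apply/measurable_EFinP; exact: measurable_sqmodulus.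
by under eq_integral do rewrite gee0_abs ?lee_fin ?sqmodulus_ge0//.
Qed.

(** The sums, multiples and restrictions of square-integrable functions are
    treated by domination. *)
Lemma L2_le (u : R -> R) f : cmeasurable f ->
  mu.-integrable [set: measurableTypeR R] (EFin \o u) ->
  (forall x, sqmodulus (f x) <= u x) -> L2 f.
Proof.
move=> mf iu fu; have [m1 m2] := mf; split => //.
have : mu.-integrable [set: measurableTypeR R] (fun x => (sqmodulus (f x))%:E).
  apply: le_integrable iu => //.
    by apply/measurable_EFinP; exact: measurable_sqmodulus.
  move=> x _ /=; rewrite lee_fin ger0_norm ?sqmodulus_ge0//.
  by rewrite (le_trans (fu x))// ler_norm.
by move=> /integrable_lty; apply.
Qed.

Lemma L2D f g : L2 f -> L2 g -> L2 (fun x => f x + g x).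
Proof.
move=> Lf Lg.
apply: (@L2_le (fun x => 2 * (sqmodulus (f x) + sqmodulus (g x)))).
- by apply: cmeasurableD; exact: L2_cmeasurable.
- have := integrableZl measurableT 2
    (integrableD measurableT (L2_integrable Lf) (L2_integrable Lg)).
  by apply: eq_integrable => // x _ /=; rewrite EFinM EFinD.
- move=> x; rewrite /sqmodulus ReD ImD.
  set a := Rez (f x); set b := Imz (f x); set c := Rez (g x); set d := Imz (g x).
  have : 0 <= (a - c) ^+ 2 + (b - d) ^+ 2 by rewrite addr_ge0 ?sqr_ge0.
  nra.
Qed.

Lemma sqmodulusM (z w : R[i]) : sqmodulus (z * w) = sqmodulus z * sqmodulus w.
Proof. by rewrite /sqmodulus ReM ImM; ring. Qed.

Lemma L2Z (c : R[i]) f : L2 f -> L2 (fun x => c * f x).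
Proof.
move=> Lf; apply: (@L2_le (fun x => sqmodulus c * sqmodulus (f x))).
- by apply: cmeasurableM; [exact: cmeasurable_cst|exact: L2_cmeasurable].
- have := integrableZl measurableT (sqmodulus c) (L2_integrable Lf).
  by apply: eq_integrable => // x _ /=; rewrite EFinM.
- by move=> x; rewrite sqmodulusM.
Qed.

Lemma L2_linear (c : R[i]) f g : L2 f -> L2 g -> L2 (fun x => c * f x + g x).
Proof. by move=> Lf Lg; apply: L2D => //; exact: L2Z. Qed.

Lemma L20 : L2 (fun=> 0 : R[i]).
Proof.
apply: (@L2_le (fun=> 0)); first exact: cmeasurable_cst.
  exact: integrable0.
by move=> x; rewrite /sqmodulus /= !expr0n addr0.
Qed.

Lemma L2B f g : L2 f -> L2 g -> L2 (fun x => f x - g x).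
Proof.
move=> Lf Lg; rewrite (_ : (fun x => _) = (fun x => f x + (-1) * g x)).
  by apply: L2D => //; exact: L2Z.
by apply/funext => x; rewrite mulN1r.
Qed.

Lemma L2_sum (F : nat -> R -> R[i]) n : (forall i, L2 (F i)) ->
  L2 (fun x => \sum_(i < n) F i x).
Proof.
move=> LF; elim: n => [|n ih].
  by under eq_fun do rewrite big_ord0; exact: L20.
by under eq_fun do rewrite big_ord_recr/=; exact: L2D.
Qed.
End SquareIntegrable.

Section RealInnerProduct.
Context {R : realType}.
Implicit Types (f g h : R -> R[i]) (S : set (measurableTypeR R)).

Local Notation mu := (@lebesgue_measure R).

(** The real part of the inner product.  Norms and orthogonality below are those
    of the underlying real Hilbert space. *)
Definition rdot f g : R :=
  \int[mu]_x (Rez (f x) * Rez (g x) + Imz (f x) * Imz (g x)).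

Lemma Re_inner f g : Rez (inner f g) = rdot f g.
Proof.
rewrite /inner /cintegral /rdot /Rintegral /=; congr fine.
by apply: eq_integral => x _; congr EFin; case: (f x) (g x) => [a b] [c d] /=; ring.
Qed.

Lemma dot_integrable f g : L2 f -> L2 g ->
  mu.-integrable [set: measurableTypeR R]
    (EFin \o (fun x => Rez (f x) * Rez (g x) + Imz (f x) * Imz (g x))).
Proof.
move=> Lf Lg.
have := integrableD measurableT (L2_integrable Lf) (L2_integrable Lg).
apply: le_integrable => //.
  by apply/measurable_EFinP; apply: measurable_dot; exact: L2_cmeasurable.
move=> x _ /=; rewrite lee_fin /sqmodulus.
set a := Rez (f x); set b := Imz (f x); set c := Rez (g x); set d := Imz (g x).
rewrite [leRHS]ger0_norm; last by rewrite !addr_ge0 ?sqr_ge0.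
have := sqr_ge0 (a - c); have := sqr_ge0 (b - d).
have := sqr_ge0 (a + c); have := sqr_ge0 (b + d).
by rewrite ler_norml => *; apply/andP; split; nra.
Qed.

Lemma rdotC f g : rdot f g = rdot g f.
Proof. by apply: eq_Rintegral => x _; ring. Qed.

Lemma rdotDl f g h : L2 f -> L2 g -> L2 h ->
  rdot (fun x => f x + g x) h = rdot f h + rdot g h.
Proof.
move=> Lf Lg Lh; rewrite /rdot -RintegralD//; [|exact: dot_integrable..].
by apply: eq_Rintegral => x _; rewrite ReD ImD; ring.
Qed.

Lemma rdotBl f g h : L2 f -> L2 g -> L2 h ->
  rdot (fun x => f x - g x) h = rdot f h - rdot g h.
Proof.
move=> Lf Lg Lh; rewrite /rdot -RintegralB//; [|exact: dot_integrable..].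
by apply: eq_Rintegral => x _; case: (f x) (g x) => [a b] [c d] /=; ring.
Qed.

Lemma aeeq_ae_eq (V : Type) (D : set (measurableTypeR R)) f g (u v : R -> V) :
  aeeq f g -> (forall x, f x = g x -> u x = v x) -> ae_eq mu D u v.
Proof.
move=> fg uv; apply: (filterS (F := almost_everywhere mu)) fg => x fgx _.
exact: uv.
Qed.

Lemma rdot_aeeq f g h : L2 f -> L2 g -> L2 h -> aeeq f g ->
  rdot f h = rdot g h.
Proof.
move=> Lf Lg Lh fg; rewrite /rdot /Rintegral; congr fine.
apply: ae_eq_integral => //.
- by apply/measurable_EFinP; apply: measurable_dot; exact: L2_cmeasurable.
- by apply/measurable_EFinP; apply: measurable_dot; exact: L2_cmeasurable.
- by apply: aeeq_ae_eq fg _ => x ->.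
Qed.

Lemma aeeq_sym f g : aeeq f g -> aeeq g f.
Proof. by apply: (filterS (F := almost_everywhere mu)) => x ->. Qed.

Lemma aeeq_trans f g h : aeeq f g -> aeeq g h -> aeeq f h.
Proof. by apply: (filterS2 (F := almost_everywhere mu)) => x -> ->. Qed.

Lemma sqnorm_aeeq f g : cmeasurable f -> cmeasurable g -> aeeq f g ->
  sqnorm f = sqnorm g.
Proof.
move=> mf mg fg; apply: ae_eq_integral => //.
- by apply/measurable_EFinP; exact: measurable_sqmodulus.
- by apply/measurable_EFinP; exact: measurable_sqmodulus.
- by apply: aeeq_ae_eq fg _ => x ->.
Qed.

Lemma sqnorm_ge0 f : (0 <= sqnorm f)%E.
Proof. by apply: integral_ge0 => x _; rewrite lee_fin sqmodulus_ge0. Qed.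

Lemma sqnormE f : L2 f -> sqnorm f = (rdot f f)%:E.
Proof.
move=> Lf; rewrite /rdot /Rintegral fineK.
  by apply: eq_integral => x _; congr EFin; rewrite /sqmodulus; ring.
exact: integrable_fin_num (dot_integrable Lf Lf).
Qed.

Lemma rdot_ge0 f : 0 <= rdot f f.
Proof. by apply: Rintegral_ge0 => x _; rewrite -!expr2 addr_ge0 ?sqr_ge0. Qed.

Lemma rdotDD f g : L2 f -> L2 g ->
  rdot (fun x => f x + g x) (fun x => f x + g x) =
  rdot f f + rdot g g + 2 * rdot f g.
Proof.
move=> Lf Lg; have Lfg := L2D Lf Lg.
rewrite rdotDl// [rdot f (fun _ => _)]rdotC [rdot g (fun _ => _)]rdotC.
by rewrite !rdotDl// [rdot g f]rdotC; ring.
Qed.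

Lemma rdotBB f g : L2 f -> L2 g ->
  rdot (fun x => f x - g x) (fun x => f x - g x) =
  rdot f f + rdot g g - 2 * rdot f g.
Proof.
move=> Lf Lg; have Lfg := L2B Lf Lg.
rewrite rdotBl// [rdot f (fun _ => _)]rdotC [rdot g (fun _ => _)]rdotC.
by rewrite !rdotBl// [rdot g f]rdotC; ring.
Qed.

Lemma rdot_eq0 f : L2 f -> rdot f f = 0 -> aeeq f (fun=> 0).
Proof.
move=> Lf f0; have : sqnorm f = 0%E by rewrite sqnormE// f0.
move=> sf0.
have mf : measurable_fun [set: measurableTypeR R] (fun x => (sqmodulus (f x))%:E).
  by apply/measurable_EFinP; apply: measurable_sqmodulus; exact: L2_cmeasurable.
have : (\int[mu]_x `|(sqmodulus (f x))%:E| = 0)%E.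
  rewrite -sf0; apply: eq_integral => x _.
  by rewrite gee0_abs// lee_fin sqmodulus_ge0.
move=> /(ae_eq_integral_abs mu measurableT mf).
by apply: (filterS (F := almost_everywhere mu)) => x /(_ I) [] /sqmodulus_eq0.
Qed.

(** The spectral projections of the position operator. *)
Definition cut S f : R -> R[i] := fun x => if x \in S then f x else 0.

Lemma cmeasurable_cut S f : measurable S -> cmeasurable f ->
  cmeasurable (cut S f).
Proof.
move=> mS mf; rewrite (_ : cut S f = fun x => (\1_S x)%:C * f x).
  apply: cmeasurableM => //; apply: cmeasurable_real.
  exact: measurable_indic.
by apply/funext => x; rewrite /cut indicE; case: ifP; rewrite ?mul1r ?mul0r.
Qed.

Lemma sqmodulus0 : sqmodulus (0 : R[i]) = 0.
Proof. by rewrite /sqmodulus /= !expr0n addr0. Qed.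

Lemma L2_cut S f : measurable S -> L2 f -> L2 (cut S f).
Proof.
move=> mS Lf; apply: (L2_le _ (L2_integrable Lf)).
  by apply: cmeasurable_cut => //; exact: L2_cmeasurable.
by move=> x; rewrite /cut; case: ifP; rewrite ?sqmodulus0 ?sqmodulus_ge0.
Qed.

Lemma sqnorm_cut S f :
  sqnorm (cut S f) = (\int[mu]_(x in S) (sqmodulus (f x))%:E)%E.
Proof.
rewrite integral_mkcond; apply: eq_integral => x _.
by rewrite /cut patchE; case: ifP => //; rewrite sqmodulus0.
Qed.

End RealInnerProduct.

(** * Integration against a density *)

Section Density.
Import HBNNSimple.

(** True for indicators by hypothesis, hence for simple functions, and for the
    others by monotone convergence. *)
Lemma ge0_integral_density d (T : measurableType d) (R : realType)
    (mu m : {measure set T -> \bar R}) (w : T -> R) (f : T -> \bar R) :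
  measurable_fun [set: T] w -> (forall x, 0 <= w x) ->
  (forall S, measurable S -> m S = (\int[mu]_(x in S) (w x)%:E)%E) ->
  measurable_fun [set: T] f -> (forall x, (0 <= f x)%E) ->
  (\int[m]_x f x = \int[mu]_x (f x * (w x)%:E))%E.
Proof.
move=> mw w0 mE mf f0.
pose h := nnsfun_approx measurableT mf.
have mwE : measurable_fun [set: T] (EFin \o w) by exact/measurable_EFinP.
have cvgh x : (EFin \o h n) x @[n --> \oo] --> f x by exact: cvg_nnsfun_approx.
transitivity (lim ((\int[m]_x (EFin \o h n) x)%E @[n --> \oo])).
  under eq_integral do rewrite -(cvg_lim _ (cvgh _))//.
  apply: monotone_convergence => //.
  - by move=> n; apply/measurable_EFinP; exact/measurable_funP.
  - by move=> n x _ /=; rewrite lee_fin.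
  - by move=> x _ a b ab; rewrite lee_fin; exact/lefP/nd_nnsfun_approx.
transitivity (lim ((\int[mu]_x ((EFin \o h n) x * (w x)%:E))%E @[n --> \oo])); last first.
  rewrite -monotone_convergence//.
  - apply: eq_integral => x _; apply/cvg_lim => //.
    by apply: cvgeZr => //; exact: cvgh.
  - move=> n; apply/emeasurable_funM => //.
    by apply/measurable_EFinP; exact/measurable_funP.
  - by move=> n x _ /=; rewrite mule_ge0 ?lee_fin.
  - move=> x _ a b ab /=; rewrite lee_wpmul2r ?lee_fin//.
    exact/lefP/nd_nnsfun_approx.
congr (lim (_ @ \oo)); apply/funext => n.
transitivity (\int[m]_x (\sum_(y \in range (h n)) (y * \1_(h n @^-1` [set y]) x)%:E))%E.
  by apply: eq_integral => t _; rewrite /= fimfunE -fsumEFin.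
have indich r : measurable_fun [set: T] (fun x => (r * \1_(h n @^-1` [set r]) x)%:E).
  by apply/measurable_EFinP/measurable_funM => //; exact: measurable_indic.
rewrite ge0_integral_fsum//; last by move=> y x _; exact: nnfun_muleindic_ge0.
transitivity (\int[mu]_x (\sum_(y \in range (h n))
    (y * \1_(h n @^-1` [set y]) x)%:E * (w x)%:E))%E; last first.
  apply: eq_integral => x _.
  rewrite -ge0_mule_fsuml => [|y]; last exact: nnfun_muleindic_ge0.
  by rewrite /= [in RHS]fimfunE -fsumEFin.
rewrite ge0_integral_fsum//; last 2 first.
  - by move=> y; apply: emeasurable_funM.
  - by move=> y x _; rewrite mule_ge0 ?lee_fin ?w0// -lee_fin nnfun_muleindic_ge0.
apply: eq_fsbigr => r; rewrite inE => -[t _ rE].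
have r0 : 0 <= r by rewrite -rE.
have mr : measurable (h n @^-1` [set r]) by exact: measurable_funPTI.
rewrite integralZl_indic_nnsfun// integral_indic// setIT mE//.
rewrite integral_mkcond -ge0_integralZl//; last 2 first.
  - exact/(measurable_restrictT _ _).1/measurable_funTS.
  - by move=> x _; rewrite erestrict_ge0// => y _; rewrite lee_fin.
apply: eq_integral => x _.
rewrite EFinM -muleA; congr *%E.
rewrite patchE indicE; case: ifP => _; rewrite ?mul1e ?mul0e//.
Qed.

Lemma integral_density d (T : measurableType d) (R : realType)
    (mu m : {measure set T -> \bar R}) (w f : T -> R) :
  measurable_fun [set: T] w -> (forall x, 0 <= w x) ->
  (forall S, measurable S -> m S = (\int[mu]_(x in S) (w x)%:E)%E) ->
  measurable_fun [set: T] f ->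
  (\int[m]_x (f x)%:E = \int[mu]_x (f x * w x)%:E)%E.
Proof.
move=> mw w0 mE mf; have mfE : measurable_fun [set: T] (EFin \o f).
  exact/measurable_EFinP.
rewrite integralE [RHS]integralE; congr (_ - _)%E.
- rewrite (@ge0_integral_density _ _ _ mu m w)//; last exact: measurable_funepos.
  apply: eq_integral => x _; rewrite !funeposE -!EFin_max -EFinM.
  by rewrite maxr_pMl// mul0r.
- rewrite (@ge0_integral_density _ _ _ mu m w)//; last exact: measurable_funeneg.
  apply: eq_integral => x _; rewrite !funenegE -!EFin_max -EFinM.
  by rewrite maxr_pMl// mul0r mulNr.
Qed.

End Density.

(** * Projection-valued measures and their spectral measures *)

Section ProjectionValuedMeasure.
Context {R : realType}.
Implicit Types (f g h : R -> R[i]) (S T : set (measurableTypeR R)).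
Variable E : set R -> (R -> R[i]) -> (R -> R[i]).
Hypothesis hE : projection_valued_measure E.

Lemma pvm_L2 S f : measurable S -> L2 f -> L2 (E S f).
Proof. by move=> /(pvm_proj hE)[[_ + _ _ _ _ _] _ _] Lf; apply. Qed.

Lemma pvm_idem S f : measurable S -> L2 f -> aeeq (E S (E S f)) (E S f).
Proof. by move=> /(pvm_proj hE)[_ + _] Lf; apply. Qed.

Lemma pvm_sym S f g : measurable S -> L2 f -> L2 g ->
  rdot (E S f) g = rdot f (E S g).
Proof. by move=> /(pvm_proj hE)[_ _ ES] Lf Lg; rewrite -!Re_inner ES. Qed.

Lemma pvm_aeeq S f g : measurable S -> L2 f -> L2 g -> aeeq f g ->
  aeeq (E S f) (E S g).
Proof. by move=> /(pvm_proj hE)[[_ _ _ + _ _ _] _ _] Lf Lg; apply. Qed.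

Lemma pvmD S f g : measurable S -> L2 f -> L2 g ->
  aeeq (E S (fun x => f x + g x)) (fun x => E S f x + E S g x).
Proof.
move=> /(pvm_proj hE)[[_ _ _ _ _ _ +] _ _] Lf Lg => /(_ 1 f g Lf Lg).
under eq_fun do rewrite mul1r.
by under [X in aeeq _ X]eq_fun do rewrite mul1r.
Qed.

Lemma pvm_linear S (c : R[i]) f g : measurable S -> L2 f -> L2 g ->
  aeeq (E S (fun x => c * f x + g x)) (fun x => c * E S f x + E S g x).
Proof. by move=> /(pvm_proj hE)[[_ _ _ _ _ _ +] _ _] Lf Lg; apply. Qed.

Lemma pvm_rdotI S T f g : measurable S -> measurable T -> L2 f -> L2 g ->
  rdot (E S f) (E T g) = rdot f (E (S `&` T) g).
Proof.
move=> mS mT Lf Lg; rewrite pvm_sym//; last exact: pvm_L2.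
rewrite rdotC [RHS]rdotC; apply: rdot_aeeq => //.
- by apply: pvm_L2 => //; exact: pvm_L2.
- by apply: pvm_L2 => //; exact: measurableI.
- exact/aeeq_sym/(pvm_setI hE).
Qed.

Lemma pvm_rdot S f : measurable S -> L2 f -> rdot f (E S f) = rdot (E S f) (E S f).
Proof. by move=> mS Lf; rewrite pvm_rdotI// setIid. Qed.

Lemma rdot0r f : L2 f -> rdot f (fun=> 0) = 0.
Proof.
move=> Lf; rewrite /rdot /Rintegral integral0_eq// => x _ /=.
by rewrite !mulr0 addr0.
Qed.

Lemma pvm_rdot_disj S T f g : measurable S -> measurable T -> S `&` T = set0 ->
  L2 f -> L2 g -> rdot (E S f) (E T g) = 0.
Proof.
move=> mS mT ST0 Lf Lg; rewrite pvm_rdotI// ST0 -[RHS](rdot0r Lf).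
rewrite rdotC [RHS]rdotC; apply: rdot_aeeq => //; first exact: pvm_L2.
  exact: L20.
exact: (pvm_set0 hE).
Qed.

(** Pythagoras: the pieces [E (F i) f] are pairwise orthogonal, and each of them
    is the projection of [E (\bigcup_i F i) f].  The first conclusion, needed for
    the induction, says that the remainder still contains the later pieces. *)
Lemma pvm_rdot_rem (F : nat -> set (measurableTypeR R)) f n :
  (forall i, measurable (F i)) -> trivIset [set: nat] F -> L2 f ->
  let D m := fun x => E (\bigcup_i F i) f x - \sum_(i < m) E (F i) f x in
  (forall j, (n <= j)%N ->
     rdot (D n) (E (F j) f) = rdot (E (F j) f) (E (F j) f)) /\
  rdot (D n) (D n) = rdot (E (\bigcup_i F i) f) (E (\bigcup_i F i) f) -
    \sum_(i < n) rdot (E (F i) f) (E (F i) f).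
Proof.
move=> mF tF Lf D.
have mU : measurable (\bigcup_i F i) by exact: bigcup_measurable.
have LE i : L2 (E (F i) f) by exact: pvm_L2.
have LD m : L2 (D m) by apply: L2B; [exact: pvm_L2|exact: (@L2_sum _ (fun i => E (F i) f))].
elim: n => [|n [ih1 ih2]].
  have -> : D 0%N = E (\bigcup_i F i) f.
    by apply/funext => x; rewrite /D big_ord0 subr0.
  split => [j _|]; last by rewrite big_ord0 subr0.
  rewrite pvm_rdotI// (setIidr (bigcup_sup _))// pvm_rdot//.
have DS : D n.+1 = fun x => D n x - E (F n) f x.
  by apply/funext => x; rewrite /D big_ord_recr/= opprD addrA.
split => [j nj|]; rewrite DS.
- rewrite rdotBl// ih1; last exact: ltnW.
  rewrite [X in _ - X]pvm_rdot_disj ?subr0//.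
  by apply: (trivIsetP.1 tF) => //; rewrite ltn_eqF.
- rewrite rdotBB// ih1// ih2 big_ord_recr/=; ring.
Qed.

(** Strong convergence of the sum of projections gives convergence of norms
    because the remainder is orthogonal to the partial sums. *)
Lemma spectral_measure_sigma_additive f : L2 f ->
  semi_sigma_additive (spectral_measure_at E f).
Proof.
move=> Lf F mF tF mU; rewrite /spectral_measure_at sqnormE; last exact: pvm_L2.
have LE i : L2 (E (F i) f) by exact: pvm_L2.
have LD m : L2 (fun x => E (\bigcup_i F i) f x - \sum_(i < m) E (F i) f x).
  by apply: L2B; [exact: pvm_L2|exact: (@L2_sum _ (fun i => E (F i) f))].
have := pvm_bigcup hE mF tF Lf.
under eq_fun do rewrite sqnormE//.
under eq_fun do rewrite (pvm_rdot_rem _ mF tF Lf).2.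
set a := rdot (E (\bigcup_n F n) f) (E (\bigcup_n F n) f).
pose s n := \sum_(i < n) rdot (E (F i) f) (E (F i) f).
rewrite (_ : (fun n => (\sum_(0 <= i < n) _)%E) = EFin \o s); last first.
  apply/funext => n; rewrite /s /= -sumEFin big_mkord.
  by apply: eq_bigr => i _; rewrite sqnormE.
move=> /fine_cvgP[_ /= h]; apply: cvg_EFin; first exact: nearW.
rewrite -[X in _ --> X]subr0.
rewrite (_ : _ \o _ = fun n => a - (a - s n)).
  by apply: cvgB => //; exact: cvg_cst.
by apply/funext => n /=; rewrite subKr.
Qed.

Lemma spectral_measure0 f : L2 f -> spectral_measure_at E f set0 = 0%E.
Proof.
move=> Lf; rewrite /spectral_measure_at (@sqnorm_aeeq _ _ (fun=> 0)).
- by apply: integral0_eq => x _; rewrite sqmodulus0.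
- exact/L2_cmeasurable/pvm_L2.
- exact: cmeasurable_cst.
- exact: (pvm_set0 hE).
Qed.

End ProjectionValuedMeasure.

Section SpectralMeasure.
Context {R : realType}.
Implicit Types (f : R -> R[i]) (S : set (measurableTypeR R)).

(** The proofs are parameters so that the structure of measure can be found from
    the term alone. *)
Definition spectral_measure E (hE : projection_valued_measure E) f (Lf : L2 f) :=
  spectral_measure_at E f.

Let spectral_measure_ge0 E (hE : projection_valued_measure E) f (Lf : L2 f) S :
  (0 <= spectral_measure hE Lf S)%E.
Proof. exact: sqnorm_ge0. Qed.

HB.instance Definition _ E (hE : projection_valued_measure E) f (Lf : L2 f) :=
  isMeasure.Build _ _ _ (spectral_measure hE Lf) (spectral_measure0 hE Lf)
    (spectral_measure_ge0 hE Lf) (spectral_measure_sigma_additive hE Lf).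

Lemma spectral_measureE E (hE : projection_valued_measure E) f (Lf : L2 f) S :
  measurable S -> spectral_measure hE Lf S = (rdot (E S f) (E S f))%:E.
Proof. by move=> mS; apply: sqnormE; exact: (pvm_L2 hE). Qed.

End SpectralMeasure.

(** * Multiplication operators *)

Section Multiplication.
Context {R : realType}.
Implicit Types (f g : R -> R[i]) (S T : set (measurableTypeR R)).

Local Notation mu := (@lebesgue_measure R).

Lemma aeeq_ext f g : (forall x, f x = g x) -> aeeq f g.
Proof. by move=> fg; exact: aeW. Qed.

Lemma aeeq_cut S f g : aeeq f g -> aeeq (cut S f) (cut S g).
Proof.
apply: (filterS (F := almost_everywhere mu)) => x fgx.
by rewrite /cut fgx.
Qed.

Lemma cut_projection S : measurable S -> orthogonal_projection (cut (R := R) S).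
Proof.
move=> mS; split.
- split => //=.
  + by move=> f; exact: L2_cut.
  + by move=> f g _ _; exact: aeeq_cut.
  + exact: L20.
  + by move=> a f g; exact: L2_linear.
  + move=> a f g _ _; apply: aeeq_ext => x; rewrite /cut.
    by case: (x \in S) => //; rewrite mulr0 addr0.
- by move=> f _; apply: aeeq_ext => x; rewrite /cut; case: (x \in S).
- move=> f g _ _; rewrite /inner; congr cintegral; apply/funext => x.
  by rewrite /cut; case: (x \in S) => //; rewrite rmorph0 mul0r mulr0.
Qed.

Lemma cutI S T f x : cut (S `&` T) f x = cut S (cut T f) x.
Proof. by rewrite /cut in_setI; case: (x \in S); case: (x \in T). Qed.

Lemma cut_bigsetU (F : nat -> set (measurableTypeR R)) f n x :
  trivIset [set: nat] F ->
  \sum_(i < n) cut (F i) f x = cut (\big[setU/set0]_(i < n) F i) f x.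
Proof.
move=> tF; elim: n => [|n ih].
  by rewrite !big_ord0 /cut in_set0.
rewrite !big_ord_recr/= ih /cut in_setU.
have [xU|] := boolP (x \in _); last by rewrite add0r.
rewrite /= [X in _ + X]ifF ?addr0//; apply/negbTE/negP => xF.
move: xU; rewrite inE -bigcup_mkord => -[k /= kn Fkx].
have := (trivIsetP.1 tF) k n I I; rewrite ltn_eqF// => /(_ isT) /seteqP[+ _].
by move=> /(_ x); apply; split => //; exact: set_mem.
Qed.

(** Sigma-additivity is dominated convergence: at each point the remainder is
    either [0] or [f], and it is eventually [0]. *)
Lemma cut_pvm : projection_valued_measure (@cut R).
Proof.
split.
- exact: cut_projection.
- by move=> f _; apply: aeeq_ext => x; rewrite /cut in_set0.
- by move=> f _; apply: aeeq_ext => x; rewrite /cut in_setT.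
- by move=> S T _ _ f _; apply: aeeq_ext => x; rewrite cutI.
move=> F mF tF f Lf.
set D := fun n x => cut (\bigcup_n F n) f x - \sum_(i < n) cut (F i) f x.
have DE n x : D n x = if (x \in \bigcup_n F n) && (x \notin \big[setU/set0]_(i < n) F i)
    then f x else 0.
  rewrite /D cut_bigsetU// /cut; have [xU|xU] := boolP (x \in \bigcup_n F n).
    by case: ifP => _ /=; rewrite ?subrr ?subr0.
  rewrite ifF ?subr0//=; apply/negbTE; apply: contra xU; rewrite !inE.
  by rewrite -bigcup_mkord => -[k _ Fkx]; exists k.
have mD n : cmeasurable (D n).
  apply: L2_cmeasurable; apply: L2B.
    by apply: L2_cut => //; exact: bigcup_measurable.
  by apply: (@L2_sum _ (fun i => cut (F i) f)) => i; exact: L2_cut.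
rewrite [X in _ --> X](_ : _ = \int[mu]_x (cst 0%E x))%E; last first.
  by rewrite integral_cst// mul0e.
have [] // := @dominated_convergence _ _ _ mu _ measurableT
  (fun n x => (sqmodulus (D n x))%:E) (cst 0%E) (fun x => (sqmodulus (f x))%:E).
- by move=> n; apply/measurable_EFinP; exact: measurable_sqmodulus.
- apply: aeW => x _; apply: cvg_near_cst.
  have [[k _ Fkx]|nF] := pselect ((\bigcup_n F n) x).
    exists k.+1 => // n /= kn; rewrite DE ifF ?sqmodulus0//.
    apply/negbTE/negP => /andP[_]; rewrite notin_setE; apply.
    by rewrite -bigcup_mkord; exists k.
  by apply: nearW => n; rewrite DE ifF ?sqmodulus0// memNset.
- exact: L2_integrable.
- apply: aeW => x n _; rewrite DE /= lee_fin ger0_norm ?sqmodulus_ge0//.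
  by case: ifP; rewrite ?sqmodulus0 ?sqmodulus_ge0.
Qed.

Lemma spectral_cut f S :
  spectral_measure_at (@cut R) f S = (\int[mu]_(x in S) (sqmodulus (f x))%:E)%E.
Proof. exact: sqnorm_cut. Qed.

Lemma measurable_Re f : cmeasurable f ->
  measurable_fun [set: measurableTypeR R] (fun x => Rez (f x)).
Proof. by case. Qed.

Lemma measurable_Im f : cmeasurable f ->
  measurable_fun [set: measurableTypeR R] (fun x => Imz (f x)).
Proof. by case. Qed.

Lemma sqnormM (phi f : R -> R[i]) :
  sqnorm (fun x => phi x * f x) =
  (\int[mu]_x ((sqmodulus (phi x))%:E * (sqmodulus (f x))%:E))%E.
Proof. by apply: eq_integral => x _; rewrite sqmodulusM EFinM. Qed.

(** The spectral measure of [f] for [cut] is [|f(x)|^2 dx], so that forms against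
    it are integrals of [phi |f|^2]; this serves both for the position operator
    and for the unitary operators [e^(i u(X))]. *)
Lemma multiplication_spectral_integral (phi : R -> R[i]) (A : operator R) :
  cmeasurable phi ->
  (forall f, dom A f <-> L2 f /\ (sqnorm (fun x => phi x * f x)%R < +oo)%E) ->
  (forall f, app A f = fun x => phi x * f x) ->
  is_spectral_integral (@cut R) phi A.
Proof.
move=> mphi domA appA.
have L2M f : L2 f -> (sqnorm (fun x => phi x * f x)%R < +oo)%E ->
    L2 (fun x => phi x * f x).
  move=> Lf foo; have [] := cmeasurableM mphi (L2_cmeasurable Lf); split => //.
have domA2 f : dom A f <-> L2 f /\ L2 (fun x => phi x * f x).
  split; first by move=> /domA[? ?]; split => //; exact: L2M.
  by move=> [? []]; rewrite domA.
split.
- split.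
  + by move=> f /domA[].
  + by move=> f /domA2[_]; rewrite appA.
  + move=> f g /domA2[Lf Lpf] Lg fg; apply/domA; split => //.
    rewrite (sqnorm_aeeq _ _ (aeeq_sym (_ : aeeq (fun x => phi x * f x) _))).
    * by case: Lpf.
    * by apply: cmeasurableM => //; exact: L2_cmeasurable.
    * exact: L2_cmeasurable.
    * by move: fg; apply: (filterS (F := almost_everywhere mu)) => x ->.
  + move=> f g _ _; rewrite !appA.
    by apply: (filterS (F := almost_everywhere mu)) => x ->.
  + apply/domA2; split; first exact: L20.
    by under eq_fun do rewrite mulr0; exact: L20.
  + move=> a f g /domA2[Lf Lpf] /domA2[Lg Lpg]; apply/domA2; split.
      exact: L2_linear.
    under eq_fun do rewrite mulrDr mulrCA.
    exact: L2_linear.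
  + move=> a f g _ _; rewrite !appA; apply: aeeq_ext => x.
    by rewrite mulrDr mulrCA.
- move=> f; rewrite domA; split => -[Lf foo]; split => //; move: foo;
  have mf := measurable_sqmodulus (L2_cmeasurable Lf);
  have mp : measurable_fun [set: measurableTypeR R] (fun x => (sqmodulus (phi x))%:E)
    by [apply/measurable_EFinP; exact: measurable_sqmodulus];
  rewrite sqnormM -(@ge0_integral_density _ _ _ mu (spectral_measure cut_pvm Lf))//.
  + by move=> x; exact: sqmodulus_ge0.
  + by move=> S mS; exact: spectral_cut.
  + by move=> x; rewrite lee_fin sqmodulus_ge0.
  + by move=> x; exact: sqmodulus_ge0.
  + by move=> S mS; exact: spectral_cut.
  + by move=> x; rewrite lee_fin sqmodulus_ge0.
- move=> f /domA2[Lf _]; rewrite /inner /cintegral appA.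
  have mf := measurable_sqmodulus (L2_cmeasurable Lf).
  congr (fine _ +i* fine _).
  + rewrite -[RHS]/(\int[spectral_measure cut_pvm Lf]_x (Rez (phi x))%:E)%E.
    rewrite (integral_density (mu := mu) (m := spectral_measure cut_pvm Lf) mf)//.
    * apply: eq_integral => x _; congr EFin; rewrite /sqmodulus.
      by case: (phi x) (f x) => [a b] [c d] /=; ring.
    * by move=> x; exact: sqmodulus_ge0.
    * by move=> S mS; exact: spectral_cut.
    * exact: measurable_Re.
  + rewrite -[RHS]/(\int[spectral_measure cut_pvm Lf]_x (Imz (phi x))%:E)%E.
    rewrite (integral_density (mu := mu) (m := spectral_measure cut_pvm Lf) mf)//.
    * apply: eq_integral => x _; congr EFin; rewrite /sqmodulus.
      by case: (phi x) (f x) => [a b] [c d] /=; ring.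
    * by move=> x; exact: sqmodulus_ge0.
    * by move=> S mS; exact: spectral_cut.
    * exact: measurable_Im.
Qed.

Lemma cmeasurable_id : cmeasurable (fun x : R => x%:C).
Proof. exact: cmeasurable_real. Qed.

Lemma position_domE f :
  dom (position R) f <-> L2 f /\ (sqnorm (fun x => x%:C * f x)%R < +oo)%E.
Proof.
rewrite sqnormM /=; split => -[Lf foo]; split => //; move: foo;
  congr (_ < _)%E; apply: eq_integral => x _;
  by rewrite -EFinM /sqmodulus/= expr0n addr0.
Qed.

Lemma position_spectral_integral :
  is_spectral_integral (@cut R) (fun x => x%:C) (position R).
Proof.
apply: multiplication_spectral_integral => //; first exact: cmeasurable_id.
exact: position_domE.
Qed.

Lemma sqmodulus_expi (x : R) : sqmodulus (expi x) = 1.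
Proof. by rewrite /sqmodulus /= cos2Dsin2. Qed.

Lemma cmeasurable_expi (u : R -> R) :
  measurable_fun [set: measurableTypeR R] u -> cmeasurable (fun x => expi (u x)).
Proof.
move=> mu_; split => /=.
  by apply: (measurableT_comp _ mu_); apply: continuous_measurable_fun;
    exact: continuous_cos.
by apply: (measurableT_comp _ mu_); apply: continuous_measurable_fun; exact: continuous_sin.
Qed.

Lemma position_functional_calculus_exists (u : R -> R) :
  measurable_fun [set: measurableTypeR R] u ->
  exists U, is_functional_calculus (position R) (fun x => expi (u x)) U.
Proof.
move=> mu_.
exists (Operator (@L2 R) (fun f x => expi (u x) * f x)), (@cut R); split.
- exact: cut_pvm.
- exact: position_spectral_integral.
- apply: multiplication_spectral_integral => //; first exact: cmeasurable_expi.
  move=> f /=; split => [Lf|[]//]; split => //.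
  have [_ _] := Lf; congr (_ < _)%E; apply: eq_integral => x _.
  by rewrite sqmodulusM sqmodulus_expi mul1r.
Qed.

End Multiplication.

(** * Ranges of spectral projections *)

Section ScaledDot.
Context {R : realType}.
Implicit Types (f g : R -> R[i]).

Lemma rdotZl (c : R) f g : L2 f -> L2 g ->
  rdot (fun x => c%:C * f x) g = c * rdot f g.
Proof.
move=> Lf Lg; rewrite /rdot -RintegralZl//; last exact: dot_integrable.
apply: eq_Rintegral => x _; case: (f x) (g x) => [u v] [u' v'] /=; ring.
Qed.

Lemma rdotZr (c : R) f g : L2 f -> L2 g ->
  rdot f (fun x => c%:C * g x) = c * rdot f g.
Proof. by move=> Lf Lg; rewrite rdotC rdotZl// rdotC. Qed.

Lemma rdotM_sym (u : R -> R) f g :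
  rdot (fun x => (u x)%:C * f x) g = rdot f (fun x => (u x)%:C * g x).
Proof.
by apply: eq_Rintegral => x _; case: (f x) (g x) => [? ?] [? ?] /=; ring.
Qed.

End ScaledDot.

Section SpectralRange.
Context {R : realType}.
Implicit Types (f g h : R -> R[i]) (S T I J : set (measurableTypeR R)).
Variable E : set R -> (R -> R[i]) -> (R -> R[i]).
Hypothesis hE : projection_valued_measure E.

Definition in_range I f := L2 f /\ aeeq (E I f) f.

Lemma in_range_pvm I f : measurable I -> L2 f -> in_range I (E I f).
Proof. by move=> mI Lf; split; [exact: (pvm_L2 hE)|exact: (pvm_idem hE)]. Qed.

Lemma in_range_linear I (c : R[i]) f g : measurable I ->
  in_range I f -> in_range I g -> in_range I (fun x => c * f x + g x).
Proof.
move=> mI [Lf If] [Lg Ig]; split; first exact: L2_linear.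
apply: aeeq_trans (pvm_linear hE _ mI Lf Lg) _.
by move: If Ig; apply: (filterS2 (F := almost_everywhere leb)) => x -> ->.
Qed.

Lemma pvm_in_range S I f : measurable S -> measurable I -> in_range I f ->
  aeeq (E S f) (E (S `&` I) f).
Proof.
move=> mS mI [Lf If].
apply: (aeeq_trans (pvm_aeeq hE mS Lf (pvm_L2 hE mI Lf) (aeeq_sym If))).
exact/aeeq_sym/(pvm_setI hE).
Qed.

Lemma pvm_disj_range S I f : measurable S -> measurable I -> S `&` I = set0 ->
  in_range I f -> aeeq (E S f) (fun=> 0).
Proof.
move=> mS mI SI If; apply: aeeq_trans (pvm_in_range mS mI If) _.
by rewrite SI; apply: (pvm_set0 hE); case: If.
Qed.

Lemma in_rangeS I J f : measurable I -> measurable J -> I `<=` J ->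
  in_range I f -> in_range J f.
Proof.
move=> mI mJ IJ If; split; first by case: If.
apply: aeeq_trans (pvm_in_range mJ mI If) _.
by rewrite (setIidr IJ); case: If.
Qed.

(** By additivity of the spectral measure, [f] and its two orthogonal projections
    satisfy Pythagoras, so that [f] minus their sum has norm [0]. *)
Lemma pvm_setC S f : measurable S -> L2 f ->
  aeeq (E (~` S) f) (fun x => f x - E S f x).
Proof.
move=> mS Lf; have mC := measurableC mS.
have LS := pvm_L2 hE mS Lf; have LC := pvm_L2 hE mC Lf.
have Lu := L2B Lf LS.
suff /rdot_eq0 : rdot (fun x => (f x - E S f x) - E (~` S) f x)
                   (fun x => (f x - E S f x) - E (~` S) f x) = 0.
  move=> /(_ (L2B Lu LC)).
  by apply: (filterS (F := almost_everywhere leb)) => x /eqP; rewrite subr_eq0 => /eqP ->.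
rewrite rdotBB// rdotBB// rdotBl// !(pvm_rdot hE)//.
rewrite (pvm_rdot_disj hE mS mC)//; last exact: setICr.
have : rdot f f = rdot (E S f) (E S f) + rdot (E (~` S) f) (E (~` S) f).
  apply: EFin_inj; rewrite EFinD -!(spectral_measureE hE Lf)// -measureU//; last exact: setICr.
  rewrite setUv -[RHS]/(sqnorm (E setT f)) -sqnormE//.
  apply: sqnorm_aeeq; [exact: L2_cmeasurable|exact/L2_cmeasurable/(pvm_L2 hE)|].
  exact/aeeq_sym/(pvm_setT hE).
by move=> ->; ring.
Qed.

Lemma spectral_measure_lty f (Lf : L2 f) S : measurable S ->
  (spectral_measure hE Lf S < +oo)%E.
Proof. by move=> mS; rewrite spectral_measureE// ltry. Qed.

Lemma spectral_measure_outside I f (If : in_range I f) : measurable I ->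
  spectral_measure hE If.1 (~` I) = 0%E.
Proof.
move=> mI; have mC := measurableC mI.
rewrite /spectral_measure /spectral_measure_at (@sqnorm_aeeq _ _ (fun=> 0)).
- by apply: integral0_eq => x _; rewrite sqmodulus0.
- exact/L2_cmeasurable/(pvm_L2 hE mC If.1).
- exact: cmeasurable_cst.
- by apply: (pvm_disj_range mC mI) => //; exact: setICl.
Qed.

Lemma spectral_measure_inside I f (If : in_range I f) : measurable I ->
  spectral_measure hE If.1 I = (rdot f f)%:E.
Proof.
move=> mI; rewrite -sqnormE; last exact: If.1.
apply: sqnorm_aeeq; last exact: If.2.
  exact/L2_cmeasurable/(pvm_L2 hE mI If.1).
exact/L2_cmeasurable/If.1.
Qed.

End SpectralRange.

(** * Uniqueness of the spectral resolution of the position operator *)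

Section PositionResolution.
Context {R : realType}.
Implicit Types (f g h : R -> R[i]) (S T I J : set (measurableTypeR R)).
Variable E : set R -> (R -> R[i]) -> (R -> R[i]).
Hypothesis hE : projection_valued_measure E.
Hypothesis hX : is_spectral_integral E (fun x => x%:C) (position R).

(** The spectral measure of a vector in the range of [E I] is carried by [I], so
    the square of the position is integrable when [I] is bounded. *)
Lemma in_range_position I (N : R) f : measurable I -> (forall x : R, I x -> `|x| <= N) ->
  in_range E I f -> dom (position R) f.
Proof.
move=> mI IN If; have [_ domX _] := hX; apply/domX; split; first by case: If.
have mC := measurableC mI.
have mx : measurable_fun [set: measurableTypeR R] (fun x : R => (sqmodulus x%:C)%:E).
  by apply/measurable_EFinP; apply: measurable_sqmodulus; exact: cmeasurable_id.
rewrite -[X in (X < _)%E]/(\int[spectral_measure hE If.1]_x (sqmodulus x%:C)%:E)%E.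
rewrite (ge0_negligible_integral mC measurableT)//.
- rewrite setTD setCK.
  apply: (@le_lt_trans _ _ (\int[spectral_measure hE If.1]_(x in I) (cst (N ^+ 2)%:E x)))%E.
    apply: ge0_le_integral => //.
    + by move=> x _; rewrite lee_fin sqmodulus_ge0.
    + exact: measurable_funTS.
    + move=> x Ix; rewrite lee_fin /sqmodulus/= expr0n addr0.
      by have := IN _ Ix; rewrite ler_norml => /andP[]; nra.
  rewrite integral_cst//= spectral_measureE// -EFinM ltry//.
- by move=> x _; rewrite lee_fin sqmodulus_ge0.
- exact: (spectral_measure_outside hE If mI).
Qed.

Lemma bounded_id_integrable I (N : R) f (Lf : L2 f) : measurable I ->
  (forall x : R, I x -> `|x| <= N) ->
  (spectral_measure hE Lf).-integrable I (EFin \o (fun x : R => x)).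
Proof.
move=> mI IN; apply: measurable_bounded_integrable => //.
- exact: spectral_measure_lty.
- exists N; split; first exact: num_real.
  by move=> M NM x Ix /=; exact: le_trans (IN _ Ix) (ltW NM).
Qed.

Lemma position_form I (N : R) f (If : in_range E I f) : measurable I ->
  (forall x : R, I x -> `|x| <= N) ->
  rdot f (fun x => x%:C * f x) = \int[spectral_measure hE If.1]_(x in I) x.
Proof.
move=> mI IN; have [_ _ formX] := hX.
have := formX f (in_range_position mI IN If) => /(congr1 (@complex.Re _)).
rewrite Re_inner => ->; rewrite /cintegral /= /Rintegral; congr fine.
rewrite [RHS]integral_mkcond.
apply: (@ae_eq_integral _ _ _ (spectral_measure hE If.1)) => //.
- apply/(measurable_restrictT _ mI); exact/measurable_EFinP.
- exists (~` I); split; first exact: measurableC.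
    exact: (spectral_measure_outside hE If mI).
  move=> x /=; apply: contra_not => Ix _; rewrite patchE mem_set//.
Qed.

Lemma position_form_bounds I (c r : R) f : measurable I ->
  (forall x : R, I x -> `|x - c| <= r) -> in_range E I f ->
  - r * rdot f f <= rdot f (fun x => (x - c)%:C * f x) <= r * rdot f f.
Proof.
move=> mI Icr If.
have IN x : I x -> `|x| <= `|c| + r.
  by move=> /Icr; have := ler_normD (x - c) c; rewrite subrK; lra.
have dX := in_range_position mI IN If.
have LX : L2 (fun x => x%:C * f x).
  by have [linX _ _] := hX; exact: (app_L2 linX dX).
have [Lf _] := If.
rewrite (_ : (fun x => _) = fun x => x%:C * f x - c%:C * f x); last first.
  by apply/funext => x; rewrite rmorphB mulrBl.
rewrite rdotC rdotBl//; last exact: L2Z.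
rewrite rdotZl// rdotC (position_form If mI IN).
have ix := bounded_id_integrable If.1 mI IN.
have ic k : (spectral_measure hE If.1).-integrable I (EFin \o cst k).
  apply: measurable_bounded_integrable => //; first exact: spectral_measure_lty.
  by exists `|k|; split => // M kM x _ /=; exact: ltW.
have muI : fine (spectral_measure hE If.1 I) = rdot f f.
  by rewrite spectral_measure_inside.
have lo : (c - r) * rdot f f <= \int[spectral_measure hE If.1]_(x in I) x.
  rewrite -muI -Rintegral_cst//; apply: le_Rintegral => //; first exact: (ic (c - r)).
  by move=> x /Icr; rewrite ler_norml => /andP[]; rewrite /=; lra.
have hi : \int[spectral_measure hE If.1]_(x in I) x <= (c + r) * rdot f f.
  rewrite -muI -Rintegral_cst//; apply: le_Rintegral => //; first exact: (ic (c + r)).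
  by move=> x /Icr; rewrite ler_norml => /andP[]; rewrite /=; lra.
by rewrite mulNr lerBrDr lerBlDr addrC -mulrBl lo addrC -mulrDl hi.
Qed.

Lemma position_L2 I (N : R) f : measurable I -> (forall x : R, I x -> `|x| <= N) ->
  in_range E I f -> L2 (fun x => x%:C * f x).
Proof.
move=> mI IN If; have [linX _ _] := hX.
exact: (app_L2 linX (in_range_position mI IN If)).
Qed.

(** The spectral measure of [f + g] agrees with that of [f] inside [I] and with
    that of [g] inside [J]; so the form of the position at [f + g] is the sum of
    its values at [f] and [g], and the cross term is zero. *)
Lemma position_form_disjoint I J (N : R) f g : measurable I -> measurable J ->
  (forall x : R, I x -> `|x| <= N) -> (forall x : R, J x -> `|x| <= N) ->
  I `&` J = set0 -> in_range E I f -> in_range E J g ->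
  rdot (fun x => x%:C * f x) g = 0.
Proof.
move=> mI mJ IN JN IJ If Jg.
have mK := measurableU _ _ mI mJ.
have Kf : in_range E (I `|` J) f by apply: (in_rangeS hE mI mK _ If).
have Kg : in_range E (I `|` J) g by apply: (in_rangeS hE mJ mK _ Jg).
have KN x : (I `|` J) x -> `|x| <= N by case; [exact: IN|exact: JN].
have Kh : in_range E (I `|` J) (fun x => f x + g x).
  have := in_range_linear hE 1 mK Kf Kg.
  by under eq_fun do rewrite mul1r.
have LXf := position_L2 mI IN If; have LXg := position_L2 mJ JN Jg.
have [[Lf _] [Lg _]] := (If, Jg).
have := position_form Kh mK KN.
rewrite Rintegral_setU//; first last.
- by rewrite disj_set2E IJ.
- by have := bounded_id_integrable Kh.1 mK KN.
(* On the subsets of [K], the projections do not see the summand [v]. *)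
have key K : measurable K -> forall (u v : R -> R[i]) (Ku : in_range E K u)
    (h : R -> R[i]) (Lh : L2 h) (Lv : L2 v),
    (forall S, measurable S -> S `<=` K -> aeeq (E S v) (fun=> 0)) ->
    h = (fun x => u x + v x) ->
    \int[spectral_measure hE Lh]_(x in K) x =
    \int[spectral_measure hE Ku.1]_(x in K) x.
  move=> mK' u v Ku h Lh Lv v0 hE'; congr fine; apply: eq_measure_integral => S mS SK.
  apply: sqnorm_aeeq; [exact/L2_cmeasurable/(pvm_L2 hE)
    |exact/L2_cmeasurable/(pvm_L2 hE mS Ku.1)|].
  rewrite hE'; apply: aeeq_trans (pvmD hE mS Ku.1 Lv) _.
  have := v0 _ mS SK.
  by apply: (filterS (F := almost_everywhere leb)) => x ->; rewrite addr0.
rewrite (key _ mI f g If)//; last first.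
  move=> S mS SI; apply: (pvm_disj_range hE mS mJ _ Jg).
  by apply/seteqP; split => // x [/SI Ix Jx]; rewrite -IJ.
rewrite (key _ mJ g f Jg)//; first last.
- by apply/funext => x; rewrite addrC.
- move=> S mS SJ; apply: (pvm_disj_range hE mS mI _ If).
  by apply/seteqP; split => // x [/SJ Jx Ix]; rewrite -IJ.
rewrite -(position_form If mI IN) -(position_form Jg mJ JN).
rewrite (_ : (fun x => x%:C * (f x + g x)) =
             fun x => x%:C * f x + x%:C * g x); last first.
  by apply/funext => x; rewrite mulrDr.
have LXfg := L2D LXf LXg; rewrite rdotDl//.
rewrite [rdot f (fun _ => _ + _)]rdotC [rdot g (fun _ => _ + _)]rdotC !rdotDl//.
have -> : rdot (fun x => x%:C * g x) f = rdot (fun x => x%:C * f x) g.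
  by rewrite rdotM_sym rdotC.
rewrite [rdot f _]rdotC [rdot g _]rdotC -!addrA => /addrI.
by rewrite addrA -[RHS]add0r => /addIr /eqP; rewrite -mulr2n mulrn_eq0 => /eqP.
Qed.

End PositionResolution.

Section SpectralSupport.
Context {R : realType}.
Implicit Types (f g h : R -> R[i]) (S T I J : set (measurableTypeR R)).
Variable E : set R -> (R -> R[i]) -> (R -> R[i]).
Hypothesis hE : projection_valued_measure E.
Hypothesis hX : is_spectral_integral E (fun x => x%:C) (position R).

Local Notation mu := (@lebesgue_measure R).

(** The component of [X f] in the range of [E J], for [J] bounded and disjoint
    from [I], is orthogonal to [X f] by [position_form_disjoint], hence zero;
    bounded sets exhaust the complement of [I]. *)
Lemma in_range_mulx I (N : R) f : measurable I ->
  (forall x : R, I x -> `|x| <= N) -> in_range E I f ->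
  in_range E I (fun x => x%:C * f x).
Proof.
move=> mI IN If; have mC := measurableC mI.
set h := fun x : R => x%:C * f x; have Lh : L2 h by exact: (position_L2 hE hX mI IN If).
split => //.
pose J n : set (measurableTypeR R) := ~` I `&` [set` `[- n%:R, n%:R]].
have mJ n : measurable (J n) by exact: measurableI.
have hJ n : rdot (E (J n) h) (E (J n) h) = 0.
  rewrite -(pvm_rdot hE)//.
  apply: (@position_form_disjoint _ _ hE hX I (J n) (Num.max N n%:R)) => //.
  - by move=> x /IN xN; rewrite le_max xN.
  - by move=> x [_]; rewrite /= in_itv/= -ler_norml => xn; rewrite le_max xn orbT.
  - by rewrite setIA setICr set0I.
  - exact: in_range_pvm.
have CE : ~` I = \bigcup_n J n.
  apply/seteqP; split => [x nIx|x [n _ []]//].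
  exists (Num.truncn `|x|).+1 => //; split => //=.
  rewrite in_itv/= -ler_norml; by apply: ltW; exact: truncnS_gt.
have EC0 : aeeq (E (~` I) h) (fun=> 0).
  apply: rdot_eq0; first exact: (pvm_L2 hE).
  apply: EFin_inj; rewrite -(spectral_measureE hE Lh mC).
  apply: measure_negligible => //; rewrite CE; apply: negligible_bigcup => n.
  apply/negligibleP => //.
  by rewrite -[LHS]/(spectral_measure hE Lh (J n)) spectral_measureE// hJ.
have := pvm_setC hE mI Lh; move: EC0.
apply: (filterS2 (F := almost_everywhere mu)) => x -> /esym/eqP.
by rewrite subr_eq0 => /eqP ->.
Qed.

Lemma in_range_mul_center I (N c : R) f : measurable I ->
  (forall x : R, I x -> `|x| <= N) -> in_range E I f ->
  in_range E I (fun x => (x - c)%:C * f x).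
Proof.
move=> mI IN If; rewrite (_ : (fun x => _) =
    fun x => (- c%:C) * f x + (x%:C * f x)).
  by apply: (in_range_linear hE) => //; exact: in_range_mulx IN If.
by apply/funext => x; rewrite rmorphB; ring.
Qed.

(** With [y = x - c], positivity of the forms of [r - y] and [r + y] gives that
    of [2 r (r^2 - y^2) = (r + y) (r - y)^2 + (r - y) (r + y)^2]. *)
Lemma in_range_contraction I (c r : R) f : measurable I -> 0 < r ->
  (forall x : R, I x -> `|x - c| <= r) -> in_range E I f ->
  rdot (fun x => (x - c)%:C * f x) (fun x => (x - c)%:C * f x) <=
  r ^+ 2 * rdot f f.
Proof.
move=> mI r0 Icr If.
have IN (x : R) : I x -> `|x| <= `|c| + r.
  by move=> /Icr; have := ler_normD (x - c) c; rewrite subrK; lra.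
pose y (u : R -> R[i]) := fun x => (x - c)%:C * u x.
rewrite -/(y f).
have yI u : in_range E I u -> in_range E I (y u).
  by move=> Iu; exact: in_range_mul_center IN Iu.
have If1 := yI _ If; have If2 := yI _ If1.
have I1 : in_range E I (fun x => (- r%:C) * f x + y f x).
  exact: (in_range_linear hE).
have I2 : in_range E I (fun x => r%:C * f x + y f x).
  exact: (in_range_linear hE).
have [[Lf _] [Lf1 _] [Lf2 _]] := And3 If If1 If2.
have /andP[B1 _] := position_form_bounds hE hX mI Icr I1.
have /andP[_ B2] := position_form_bounds hE hX mI Icr I2.
have ysym u v : rdot (y u) v = rdot u (y v) by exact: rdotM_sym.
have form (k : R) :
    rdot (fun x => k%:C * f x + y f x) (fun x => k%:C * f x + y f x) =
      k ^+ 2 * rdot f f + rdot (y f) (y f) + 2 * (k * rdot f (y f)) /\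
    rdot (fun x => k%:C * f x + y f x) (y (fun x => k%:C * f x + y f x)) =
      k ^+ 2 * rdot f (y f) + 2 * (k * rdot (y f) (y f)) + rdot (y f) (y (y f)).
  have Lk := L2Z k%:C Lf; have Lk1 := L2Z k%:C Lf1; have Lk12 := L2D Lk1 Lf2.
  split.
    by rewrite rdotDD// !rdotZl// rdotZr//; ring.
  pose w x := k%:C * y f x + y (y f) x.
  have -> : y (fun x => k%:C * f x + y f x) = w.
    by apply/funext => x; rewrite /w /y; ring.
  have dw u : L2 u -> rdot u w = k * rdot u (y f) + rdot u (y (y f)).
    by move=> Lu; rewrite rdotC rdotDl// rdotZl// rdotC (rdotC _ u).
  rewrite rdotDl// rdotZl// !dw// -(ysym f (y f)); ring.
have [f1 f1'] := form (- r); have [f2 f2'] := form r.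
rewrite rmorphN/= in f1 f1'.
move: B1 B2; rewrite -/(y _) f1 f1' -/(y _) f2 f2'.
move: (rdot f f) (rdot (y f) (y f)) (rdot f (y f)) (rdot (y f) (y (y f))).
move=> a b d e; rewrite sqrrN => B1 B2.
have : 0 <= r * (r ^+ 2 * a - b) by clear -B1 B2; nra.
by rewrite pmulr_rge0// subr_ge0.
Qed.

Lemma in_range_power I (c r : R) f k : measurable I -> 0 < r ->
  (forall x : R, I x -> `|x - c| <= r) -> in_range E I f ->
  let g := fun x => ((x - c) ^+ k)%:C * f x in
  in_range E I g /\ rdot g g <= (r ^+ 2) ^+ k * rdot f f.
Proof.
move=> mI r0 Icr If.
have IN (x : R) : I x -> `|x| <= `|c| + r.
  by move=> /Icr; have := ler_normD (x - c) c; rewrite subrK; lra.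
elim: k => [|k [ihI ih]] /=.
  by under eq_fun do rewrite expr0 mul1r; rewrite expr0 mul1r.
rewrite (_ : (fun x => _) =
    fun x => (x - c)%:C * (((x - c) ^+ k)%:C * f x)); last first.
  by apply/funext => x; rewrite exprS rmorphM mulrA.
split; first exact: in_range_mul_center IN ihI.
apply: le_trans (in_range_contraction mI r0 Icr ihI) _.
by rewrite [in leRHS]exprS -mulrA ler_wpM2l ?sqr_ge0.
Qed.

(** For [s > r], the mass of [f] on [|x - c| >= s] is at most [(r / s)^(2k)] times
    the total mass for every [k]. *)
Lemma in_range_support I (c r : R) f : measurable I -> 0 < r ->
  (forall x : R, I x -> `|x - c| <= r) -> in_range E I f ->
  \forall x \ae mu, r < `|x - c| -> f x = 0.
Proof.
move=> mI r0 Icr If; have Lf := If.1.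
have far (s : R) : r < s -> \forall x \ae mu, s <= `|x - c| -> f x = 0.
  move=> rs; have s0 : 0 < s by exact: lt_trans rs.
  pose A : set (measurableTypeR R) := [set x : R | s <= `|x - c|].
  have mA : measurable A.
    rewrite -[A]setTI; apply: (measurable_fun_le (f := cst s) (g := fun x : R => `|x - c|)) => //.
    by apply: measurableT_comp => //; exact: measurable_funB.
  have LA := L2_cut mA Lf.
  suff /(rdot_eq0 LA) : rdot (cut A f) (cut A f) = 0.
    apply: (filterS (F := almost_everywhere mu)) => x.
    by rewrite /cut; case: ifP => // /negbT; rewrite notin_setE /A/=.
  apply/eqP; rewrite eq_le rdot_ge0 andbT.
  have bound k : rdot (cut A f) (cut A f) <= ((r / s) ^+ 2) ^+ k * rdot f f.
    have [Ig gb] := in_range_power k mI r0 Icr If.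
    have sk : 0 < (s ^+ 2) ^+ k by rewrite !exprn_gt0.
    rewrite -(ler_pM2l sk) mulrA -exprMn -exprMn mulrCA divff ?gt_eqF// mulr1.
    apply: le_trans gb.
    rewrite -exprM mulnC exprM expr2 -mulrA -rdotZr// -rdotZl//; last exact: L2Z.
    have Lg := Ig.1; have LAs := L2Z (s ^+ k)%:C LA.
    apply: le_Rintegral => //; [exact: dot_integrable..|].
    move=> x _; rewrite /cut; case: ifPn => [|_].
      rewrite inE /A/= => sx.
      have skx : (s ^+ k) ^+ 2 <= ((x - c) ^+ k) ^+ 2.
        rewrite -exprM mulnC exprM -[leRHS]exprM mulnC exprM lerXn2r ?nnegrE ?sqr_ge0//.
        by rewrite -[leRHS]real_normK ?num_real// lerXn2r ?nnegrE// ltW.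
      case: (f x) => a b /=; have := sqr_ge0 a; have := sqr_ge0 b.
      rewrite !mul0r !subr0 !addr0; nra.
    by rewrite mulr0 /= mul0r addr0 -!expr2 addr_ge0 ?sqr_ge0.
  have lim0 : ((r / s) ^+ 2) ^+ k * rdot f f @[k --> \oo] --> (0 : R).
    rewrite -[X in _ --> X](mul0r (rdot f f)); apply: cvgMr_tmp.
    apply: cvg_expr; rewrite ger0_norm ?sqr_ge0// exprn_ilt1//.
      by rewrite divr_ge0// ltW.
    by rewrite ltr_pdivrMr// mul1r.
  by apply: (cvgr_to_ge lim0); exact: nearW.
have /ae_foralln : forall n : nat,
    \forall x \ae mu, r + n.+1%:R^-1 <= `|x - c| -> f x = 0.
  by move=> n; apply: far; rewrite ltrDl invr_gt0.
apply: (filterS (F := almost_everywhere mu)) => x fx rx.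
have d0 : 0 < `|x - c| - r by rewrite subr_gt0.
apply: (fx (Num.truncn (`|x - c| - r)^-1)).
rewrite -lerBrDl -[leRHS]invrK lef_pV2 ?posrE ?invr_gt0//.
by rewrite ltW// truncnS_gt.
Qed.

End SpectralSupport.

Section PositionSpectralMeasure.
Context {R : realType}.
Implicit Types (f g h : R -> R[i]) (S T I J B : set (measurableTypeR R)).
Variable E : set R -> (R -> R[i]) -> (R -> R[i]).
Hypothesis hE : projection_valued_measure E.
Hypothesis hX : is_spectral_integral E (fun x => x%:C) (position R).

Local Notation mu := (@lebesgue_measure R).

(** Vanishing almost everywhere on [B] passes to limits in the mean, and [E S f]
    is the limit of its projections on the bounded parts of [S]. *)
Lemma pvm_vanish S B f : measurable S -> measurable B -> L2 f ->
  (forall J (N : R) g, measurable J -> J `<=` S ->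
    (forall x : R, J x -> `|x| <= N) -> in_range E J g ->
    \forall x \ae mu, B x -> g x = 0) ->
  \forall x \ae mu, B x -> E S f x = 0.
Proof.
move=> mS mB Lf vanish.
pose K n : set (measurableTypeR R) := [set` `[- n%:R, n%:R]].
pose F i := S `&` seqDU K i.
have mF i : measurable (F i).
  by apply: measurableI => //; apply: seqDU_measurable => n; exact: measurable_itv.
have tF : trivIset [set: nat] F.
  exact/trivIset_setIl/trivIset_seqDU.
have UF : \bigcup_i F i = S.
  rewrite -setI_bigcupr -seqDU_bigcup_eq; apply/seteqP; split => [x []//|x Sx].
  split => //; exists (Num.truncn `|x|).+1 => //.
  by rewrite /K /= in_itv/= -ler_norml; apply: ltW; exact: truncnS_gt.
have LES := pvm_L2 hE mS Lf.
pose D n x := E S f x - \sum_(i < n) E (F i) f x.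
have LD n : L2 (D n).
  apply: L2B => //; apply: (@L2_sum _ (fun i => E (F i) f)) => i.
  exact: (pvm_L2 hE).
have D0 : sqnorm (D n) @[n --> \oo] --> 0%E.
  by have := pvm_bigcup hE mF tF Lf; rewrite UF.
have FB : \forall x \ae mu, forall i, B x -> E (F i) f x = 0.
  apply: ae_foralln => i; apply: (vanish (F i) i%:R) => //.
  - by move=> x [].
  - by move=> x [_ Kx]; have := @subset_seqDU _ _ _ _ Kx; rewrite /K/= in_itv/= -ler_norml.
  - exact: (in_range_pvm hE).
have LB := L2_cut mB LES.
have le n : (sqnorm (cut B (E S f)) <= sqnorm (D n))%E.
  rewrite (@sqnorm_aeeq _ _ (cut B (D n))).
  - apply: ge0_le_integral => //.
    + by move=> x _; rewrite lee_fin sqmodulus_ge0.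
    + apply/measurable_EFinP; apply: measurable_sqmodulus.
      by apply: L2_cmeasurable; exact: L2_cut.
    + by apply/measurable_EFinP; apply: measurable_sqmodulus; exact: L2_cmeasurable.
    + move=> x _; rewrite lee_fin /cut; case: ifP => // _.
      by rewrite sqmodulus0 sqmodulus_ge0.
  - exact: L2_cmeasurable.
  - by apply: L2_cmeasurable; exact: L2_cut.
  - move: FB; apply: (filterS (F := almost_everywhere mu)) => x Fx.
    rewrite /cut; case: ifP => // /set_mem Bx; rewrite /D big1 ?subr0// => i _.
    exact: Fx.
have /(rdot_eq0 LB) : rdot (cut B (E S f)) (cut B (E S f)) = 0.
  apply/eqP; rewrite eq_le rdot_ge0 andbT -lee_fin -sqnormE//.
  by apply: (cvge_to_ge D0); exact: nearW.
apply: (filterS (F := almost_everywhere mu)) => x.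
by rewrite /cut => + Bx; rewrite mem_set.
Qed.

(** The components of [f] in the ranges of [E H] and of [E (~` H)] vanish on the
    opposite open half-lines and add up to [f]. *)
Lemma position_resolution_halfline (a : R) f : L2 f ->
  aeeq (E [set` `]-oo, a[] f) (cut [set` `]-oo, a[] f).
Proof.
move=> Lf; set H : set (measurableTypeR R) := [set` _].
have mH : measurable H by exact: measurable_itv.
have mC := measurableC mH.
have HC0 : \forall x \ae mu, [set` `]a, +oo[] x -> E H f x = 0.
  apply: pvm_vanish => // J N g mJ JH JN Jg.
  (* [J] lies in [[- M, a]], of positive length since [M >= 1 - a]. *)
  pose M := Num.max N (1 - a).
  have MN x : J x -> `|x| <= M by move=> /JN xN; rewrite le_max xN.
  have Ma : 1 - a <= M by rewrite le_max lexx orbT.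
  have r0 : 0 < (a + M) / 2 by rewrite divr_gt0//; lra.
  have := @in_range_support _ _ hE hX J ((a - M) / 2) ((a + M) / 2) g mJ r0.
  have Jr (x : R) : J x -> `|x - (a - M) / 2| <= (a + M) / 2.
    move=> Jx; have := JH _ Jx; rewrite /H/= in_itv/= => xa.
    by have := MN _ Jx; rewrite !ler_norml => /andP[? ?]; apply/andP; split; lra.
  move=> /(_ Jr Jg); apply: (filterS (F := almost_everywhere mu)) => x gx.
  by rewrite /= in_itv/= andbT => ax; apply: gx; rewrite ltr_normr; apply/orP; left; lra.
have H0 : \forall x \ae mu, [set` `]-oo, a[] x -> E (~` H) f x = 0.
  apply: pvm_vanish => // J N g mJ JH JN Jg.
  pose M := Num.max N (1 + a).
  have MN x : J x -> `|x| <= M by move=> /JN xN; rewrite le_max xN.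
  have Ma : 1 + a <= M by rewrite le_max lexx orbT.
  have r0 : 0 < (M - a) / 2 by rewrite divr_gt0//; lra.
  have := @in_range_support _ _ hE hX J ((a + M) / 2) ((M - a) / 2) g mJ r0.
  have Jr (x : R) : J x -> `|x - (a + M) / 2| <= (M - a) / 2.
    move=> Jx; have := JH _ Jx; rewrite /H/= in_itv/= => /negP; rewrite -leNgt => xa.
    by have := MN _ Jx; rewrite !ler_norml => /andP[? ?]; apply/andP; split; lra.
  move=> /(_ Jr Jg); apply: (filterS (F := almost_everywhere mu)) => x gx.
  by rewrite /= in_itv/= => ax; apply: gx; rewrite ltr_normr; apply/orP; right; lra.
have na : \forall x \ae mu, x <> a.
  exists [set a]; split; [exact: measurable_set1|exact: lebesgue_measure_set1|].
  by move=> x /= /contrapT.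
have FF : Filter (almost_everywhere mu) by exact: ae_filter_ringOfSetsType.
have := @filterI _ _ FF _ _ HC0 (@filterI _ _ FF _ _ H0 na).
move: (pvm_setC hE mH Lf); apply: (filterS2 (F := almost_everywhere mu)).
move=> x xC [Hx [Cx xa]]; rewrite /cut.
have [xlt|] := ltP x a.
  have Hxa : H x by rewrite /H/= in_itv.
  by rewrite mem_set//; apply/esym/eqP; rewrite -subr_eq0 -xC Cx.
rewrite le_eqVlt => /predU1P[/esym//|ax].
rewrite Hx; last by rewrite /= in_itv/= ax.
by rewrite memNset// /H/= in_itv/= => /(lt_trans ax); rewrite ltxx.
Qed.

(** Both sides are finite measures, and they agree on the half-lines, which
    generate the Borel sets. *)
Lemma position_spectral_measure f S : L2 f -> measurable S ->
  spectral_measure_at E f S = spectral_measure_at (@cut R) f S.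
Proof.
move=> Lf mS.
apply: (@measure_unique _ R (measurableTypeR R) (@RGenInftyO.G R)
  (fun n => [set` `]-oo, n%:R[]) _ _ _ _ (spectral_measure hE Lf)
  (spectral_measure cut_pvm Lf)) => //.
- exact: RGenInftyO.measurableE.
- move=> _ _ [a ->] [b ->]; exists (Num.min a b); apply/seteqP; split => x /=.
    by rewrite !in_itv/= lt_min => -[-> ->].
  by rewrite !in_itv/= lt_min => /andP[-> ->].
- by move=> i; exists i%:R.
- apply/seteqP; split => // x _; exists (Num.truncn x).+1 => //=.
  by rewrite in_itv/= truncnS_gt.
- move=> _ [a ->]; apply: sqnorm_aeeq; last exact: position_resolution_halfline.
    by apply/L2_cmeasurable/(pvm_L2 hE) => //; exact: measurable_itv.
  by apply/L2_cmeasurable/L2_cut => //; exact: measurable_itv.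
- by move=> k; apply: spectral_measure_lty; exact: measurable_itv.
Qed.

End PositionSpectralMeasure.

(** The form of [U] at [f] depends on the resolution of the identity only through
    the spectral measure of [f], which is that of [cut]. *)
Lemma position_functional_calculus (R : realType) (phi : R -> R[i])
    (U : operator R) (f : R -> R[i]) :
  cmeasurable phi -> is_functional_calculus (position R) phi U ->
  L2 f -> L2 (fun x => phi x * f x) ->
  inner f (U f) = inner f (fun x => phi x * f x).
Proof.
move=> mphi [E [hE hX [_ domU formU]]] Lf Lpf.
pose M := Operator [set f : R -> R[i] | L2 f /\ (sqnorm (fun x => phi x * f x)%R < +oo)%E]
  (fun f x => phi x * f x).
have [_ domM formM] : is_spectral_integral (@cut R) phi M.
  by apply: multiplication_spectral_integral.
have dM : dom M f by split => //; case: Lpf.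
have muE (u : R -> \bar R) : (\int[spectral_measure_at E f]_x u x =
    \int[spectral_measure_at (@cut R) f]_x u x)%E.
  apply: (@eq_measure_integral _ _ _ _ (spectral_measure cut_pvm Lf)
    (spectral_measure hE Lf)) => S mS _.
  exact: position_spectral_measure.
have dU : dom U f.
  by apply/domU; split => //; rewrite muE; have /domM[] := dM.
by rewrite (formU _ dU) (formM _ dM) /cintegral !muE.
Qed.

(** * Deformation of the path of integration *)

Section PointwiseRules.
Context {R : realType}.

Context {T : topologicalType}.
Implicit Types (f g : T -> R) (z : T).

Lemma conD f g z : continuous_at z f -> continuous_at z g ->
  continuous_at z (fun y => f y + g y).
Proof. exact: cvgD. Qed.

Lemma conN f z : continuous_at z f -> continuous_at z (fun y => - f y).
Proof. exact: cvgN. Qed.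

Lemma conM f g z : continuous_at z f -> continuous_at z g ->
  continuous_at z (fun y => f y * g y).
Proof. exact: cvgM. Qed.

Lemma conC (c : R) z : continuous_at z (fun=> c).
Proof. exact: cvg_cst. Qed.

Lemma conX n f z : continuous_at z f -> continuous_at z (fun y => f y ^+ n).
Proof.
move=> cf; elim: n => [|n ih]; first exact: conC.
rewrite (_ : (fun y => _) = (fun y => f y * f y ^+ n)); first exact: conM.
by apply/funext => y; rewrite exprS.
Qed.

Lemma concomp (h : R -> R) f z : continuous h -> continuous_at z f ->
  continuous_at z (fun y => h (f y)).
Proof. by move=> ch cf; apply: continuous_comp => //; exact: ch. Qed.

End PointwiseRules.

Local Ltac continuity leaf := lazymatch goal with
| |- continuous_at _ (fun x => _ + _) => apply: conD; continuity leaf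
| |- continuous_at _ (fun x => _ * _) => apply: conM; continuity leaf
| |- continuous_at _ (fun x => - _) => apply: conN; continuity leaf
| |- continuous_at _ (fun x => _ ^+ _) => apply: conX; continuity leaf
| |- continuous_at _ (fun x => expR _) =>
  apply: (@concomp _ _ expR); [exact: continuous_expR | continuity leaf]
| |- continuous_at _ (fun x => cos _) =>
  apply: (@concomp _ _ cos); [exact: continuous_cos | continuity leaf]
| |- continuous_at _ (fun x => sin _) =>
  apply: (@concomp _ _ sin); [exact: continuous_sin | continuity leaf]
| |- _ => first [leaf | exact: conC]
end.

Section Homotopy.
Context {R : realType}.
Variables (t : R) (p q p' q' : R -> R).
Hypothesis Dp : forall s : R, is_derive s 1 p (p' s).
Hypothesis Dq : forall s : R, is_derive s 1 q (q' s).
Hypothesis Cp' : continuous p'.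
Hypothesis Cq' : continuous q'.

Local Notation mu := (@lebesgue_measure R).

(** The real and imaginary parts of [i t z^3 - z^2] at [z = x + i y]. *)
Definition reE (x y : R) := - x ^+ 2 + y ^+ 2 - 3 * t * x ^+ 2 * y + t * y ^+ 3.
Definition imE (x y : R) := t * x ^+ 3 - 3 * t * x * y ^+ 2 - 2 * x * y.

(** With [z = p + i l q] and [g z = i t z^3 - z^2], [integrand] is the real part
    of [e^(g z) dz/ds], [flux] is the real part of [e^(g z) dz/dl], and
    [dintegrand] is their common derivative, with respect to [l] and to [s]
    respectively; [a + i b] in its body is [g' z]. *)
Definition integrand (l s : R) :=
  expR (reE (p s) (l * q s)) *
  (cos (imE (p s) (l * q s)) * p' s - sin (imE (p s) (l * q s)) * (l * q' s)).

Definition flux (l s : R) :=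
  - (expR (reE (p s) (l * q s)) * sin (imE (p s) (l * q s)) * q s).

Definition dintegrand (l s : R) :=
  let x := p s in let y := l * q s in
  let a := - 6 * t * x * y - 2 * x in
  let b := 3 * t * (x ^+ 2 - y ^+ 2) - 2 * y in
  let c := cos (imE x y) in let d := sin (imE x y) in
  expR (reE x y) * (- (b * q s) * (c * p' s - d * (l * q' s))
    - a * q s * (d * p' s + c * (l * q' s)) - d * q' s).

Lemma is_derive_integrand (l s : R) : is_derive l 1 (integrand^~ s) (dintegrand l s).
Proof.
rewrite /integrand /reE /imE; apply: is_derive_eq.
rewrite /dintegrand /reE /imE /GRing.scale/=; ring.
Qed.

Lemma is_derive_flux (l s : R) : is_derive s 1 (flux l) (dintegrand l s).
Proof.
rewrite /flux /reE /imE; apply: is_derive_eq.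
rewrite /dintegrand /reE /imE /GRing.scale/=; ring.
Qed.

Lemma is_derive_continuous (f f' : R -> R) :
  (forall s : R, is_derive s 1 f (f' s)) -> continuous f.
Proof.
move=> Df s; apply/differentiable_continuous/derivable1_diffP.
by have [] := Df s.
Qed.

Let Cp : continuous p. Proof. exact: is_derive_continuous Dp. Qed.
Let Cq : continuous q. Proof. exact: is_derive_continuous Dq. Qed.

Let leafc (r : R -> R) (z : R * R) : continuous r ->
  continuous_at z (fun z : R * R => r z.2).
Proof. by move=> cr; apply: continuous_comp; [exact: cvg_snd|exact: cr]. Qed.

Lemma continuous_integrand l : continuous (integrand l).
Proof.
move=> s; rewrite /integrand /reE /imE.
have cp : continuous_at s p by exact: Cp.
have cq : continuous_at s q by exact: Cq.
have cp' : continuous_at s p' by exact: Cp'.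
have cq' : continuous_at s q' by exact: Cq'.
by continuity assumption.
Qed.

Lemma continuous_dintegrandr l : continuous (dintegrand l).
Proof.
move=> s; rewrite /dintegrand /reE /imE /=.
have cp : continuous_at s p by exact: Cp.
have cq : continuous_at s q by exact: Cq.
have cp' : continuous_at s p' by exact: Cp'.
have cq' : continuous_at s q' by exact: Cq'.
by continuity assumption.
Qed.

Lemma continuous_dintegrand : continuous (fun z : R * R => dintegrand z.1 z.2).
Proof.
move=> z; rewrite /dintegrand /reE /imE /=.
have c1 : continuous_at z (fun z : R * R => z.1) by exact: cvg_fst.
have cp := @leafc _ z Cp; have cq := @leafc _ z Cq.
have cp' := @leafc _ z Cp'; have cq' := @leafc _ z Cq'.
by continuity assumption.
Qed.

End Homotopy.

Section HomotopyIntegral.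
Context {R : realType}.
Variables (t : R) (p q p' q' : R -> R).
Hypothesis Dp : forall s : R, is_derive s 1 p (p' s).
Hypothesis Dq : forall s : R, is_derive s 1 q (q' s).
Hypothesis Cp' : continuous p'.
Hypothesis Cq' : continuous q'.

Local Notation mu := (@lebesgue_measure R).
Local Notation integrand := (integrand t p q p' q').
Local Notation dintegrand := (dintegrand t p q p' q').
Local Notation flux := (flux t p q).

Lemma integrable_integrand (l V : R) :
  mu.-integrable [set` `[0, V]] (EFin \o integrand l).
Proof.
apply: continuous_compact_integrable; first exact: segment_compact.
apply: continuous_subspaceT; exact: (continuous_integrand Dp Dq Cp' Cq').
Qed.

(** The interval [[-1, 2]] is a neighbourhood of the range [[0, 1]] of [l], for
    differentiation under the integral sign. *)
Lemma dintegrand_bounded (V : R) : exists2 M : R, 0 <= M &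
  forall l s : R, -1 <= l <= 2 -> 0 <= s <= V -> `|dintegrand l s| <= M.
Proof.
have cK : compact ([set` `[-1, 2]] `*` [set` `[0, V]] : set (R * R)).
  by apply: compact_setX; exact: segment_compact.
have := continuous_compact (continuous_subspaceT (continuous_dintegrand (t := t) Dp Dq Cp' Cq')) cK.
move=> /compact_bounded-[M [_ /(_ (`|M| + 1))]].
have -> : M < `|M| + 1 by rewrite (le_lt_trans (ler_norm M))// ltrDl.
move=> /(_ isT) bM; exists (`|M| + 1); first by rewrite addr_ge0.
move=> l s l12 sV; apply: bM => /=; by exists (l, s) => //=.
Qed.

Lemma is_derive_homotopy (V a : R) : 0 < V -> -1 < a < 2 ->
  is_derive a 1 (fun l => \int[mu]_(s in [set` `[0, V]]) integrand l s)
    (\int[mu]_(s in [set` `[0, V]]) dintegrand a s).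
Proof.
move=> V0 a12; have [M M0 hM] := dintegrand_bounded V.
have Ia : [set` `]-1, 2[] a by rewrite /= in_itv.
have Di (l s : R) : is_derive l 1 (integrand^~ s) (dintegrand l s).
  exact: is_derive_integrand.
have d1 (l s : R) : partial1of2 integrand l s = dintegrand l s.
  by rewrite partial1of2E; have [_] := Di l s.
have mV : measurable ([set` `[0, V]] : set (measurableTypeR R)) by exact: measurable_itv.
have intf (l : R) : [set` `]-1, 2[] l -> mu.-integrable [set` `[0, V]] (EFin \o integrand l).
  by move=> _; exact: integrable_integrand.
have der (l s : R) : [set` `]-1, 2[] l -> [set` `[0, V]] s -> derivable (integrand^~ s) l 1.
  by move=> _ _; have [] := Di l s.
have intM : mu.-integrable [set` `[0, V]] (EFin \o (fun=> M)).
  apply: measurable_bounded_integrable => //.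
    by rewrite /= lebesgue_measure_itv/=; case: ifP; rewrite ?ltry.
  by exists M; split; [exact: num_real|move=> N MN x _ /=; rewrite ger0_norm// ltW].
have ub (l s : R) : [set` `]-1, 2[] l -> [set` `[0, V]] s -> `|partial1of2 integrand l s| <= M.
  rewrite /= !in_itv/= => /andP[l1 l2] sV; rewrite d1; apply: hM => //.
  by rewrite !ltW.
apply: DeriveDef.
  exact: (derivable_under_integral mV Ia intf der (fun=> M0) intM ub).
rewrite -derive1E (differentiation_under_integral mV Ia intf der (fun=> M0) intM ub).
by apply: eq_Rintegral => s _; rewrite d1.
Qed.

Lemma integral_dintegrand (V l : R) : 0 < V ->
  \int[mu]_(s in [set` `[0, V]]) dintegrand l s = flux l V - flux l 0.
Proof.
move=> V0; have Df (s : R) : is_derive s 1 (flux l) (dintegrand l s).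
  exact: is_derive_flux.
have cf : continuous (flux l) by exact: is_derive_continuous Df.
rewrite /Rintegral (@continuous_FTC2 _ _ (flux l)) ?fineB//.
- apply: continuous_subspaceT; exact: (continuous_dintegrandr Dp Dq Cp' Cq').
- split.
  + by move=> s _; have [] := Df s.
  + exact: cvg_at_right_filter (cf 0).
  + exact: cvg_at_left_filter (cf V).
- by move=> s _; rewrite derive1E; have [_] := Df s.
Qed.

(** Mean value theorem for the integral as a function of [l].  The starting point
    of the curves is fixed ([q 0 = 0]), so only the flux at [V] remains. *)
Lemma homotopy_difference (V : R) : 0 < V -> q 0 = 0 ->
  exists2 c : R, 0 < c < 1 &
    \int[mu]_(s in [set` `[0, V]]) integrand 1 s -
    \int[mu]_(s in [set` `[0, V]]) integrand 0 s = flux c V.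
Proof.
move=> V0 q0.
have D (a : R) : -1 < a < 2 -> is_derive a 1
    (fun l => \int[mu]_(s in [set` `[0, V]]) integrand l s) (flux a V).
  move=> a12; rewrite -[flux a V]subr0.
  have {2}<- : flux a 0 = 0 by rewrite /flux q0 !mulr0 oppr0.
  by rewrite -integral_dintegrand//; exact: is_derive_homotopy.
have [] := @MVT R (fun l => \int[mu]_(s in [set` `[0, V]]) integrand l s)
   (flux^~ V) 0 1 ltr01.
- by move=> x; rewrite in_itv/= => /andP[x0 x1]; apply: D; apply/andP; split; lra.
- apply: derivable_within_continuous => x; rewrite in_itv/= => /andP[x0 x1].
  by have [|] := D x; first by apply/andP; split; lra.
- by move=> c; rewrite in_itv/= => c01; rewrite subr0 mulr1; exists c.
Qed.

End HomotopyIntegral.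

(** * The Bessel integral *)

Section Hyperbolic.
Context {R : realType}.
Implicit Types x y : R.

Definition sinh x : R := (expR x - expR (- x)) / 2.

Lemma expRKN x : expR x * expR (- x) = 1.
Proof. by rewrite -expRD subrr expR0. Qed.

Lemma cosh2_sinh2 x : sinh x ^+ 2 = cosh x ^+ 2 - 1.
Proof.
rewrite /sinh /cosh; have := expRKN x; move: (expR x) (expR (- x)) => a b ab.
have -> : ((a - b) / 2) ^+ 2 = ((a + b) / 2) ^+ 2 - a * b by field.
by rewrite ab.
Qed.

Lemma cosh_triple x : cosh (3 * x) = 4 * cosh x ^+ 3 - 3 * cosh x.
Proof.
rewrite /cosh.
have -> : expR (3 * x) = expR x ^+ 3 by rewrite -expRM_natl.
have -> : expR (- (3 * x)) = expR (- x) ^+ 3 by rewrite -mulrN -expRM_natl.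
have := expRKN x; move: (expR x) (expR (- x)) => a b ab.
have aab : a ^+ 2 * b = a by rewrite expr2 -mulrA ab mulr1.
have abb : a * b ^+ 2 = b by rewrite expr2 mulrA ab mul1r.
have -> : 4 * ((a + b) / 2) ^+ 3 = (a ^+ 3 + b ^+ 3 + 3 * (a ^+ 2 * b) + 3 * (a * b ^+ 2)) / 2.
  by field.
by rewrite aab abb; field.
Qed.

Lemma cosh_ge1 x : 1 <= cosh x.
Proof.
rewrite /cosh; have := expRKN x; have := expR_gt0 x; have := expR_gt0 (- x).
by move: (expR x) (expR (- x)) => a b b0 a0 ab; have := sqr_ge0 (a - b); nra.
Qed.

Lemma sinh0 : sinh 0 = 0.
Proof. by rewrite /sinh oppr0 subrr mul0r. Qed.

Lemma cosh0 : cosh 0 = 1 :> R.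
Proof. by rewrite /cosh oppr0 expR0; field. Qed.

Lemma sinh_lt x y : x < y -> sinh x < sinh y.
Proof.
move=> xy; rewrite /sinh ltr_pM2r ?invr_gt0// ltrB// ltr_expR//.
by rewrite ltrN2.
Qed.

Lemma sinh_ge x : 0 <= x -> x / 2 <= sinh x.
Proof.
move=> x0; have := expR_ge1Dx x; have : expR (- x) <= 1.
  by rewrite -expR0 ler_expR oppr_le0.
rewrite /sinh; lra.
Qed.

Lemma is_derive_sinh x : is_derive x 1 sinh (cosh x).
Proof.
rewrite /sinh; apply: is_derive_eq.
by rewrite /cosh /GRing.scale/=; field.
Qed.

Lemma is_derive_cosh x : is_derive x 1 cosh (sinh x).
Proof.
rewrite /cosh; apply: is_derive_eq.
by rewrite /sinh /GRing.scale/=; field.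
Qed.

End Hyperbolic.

Section CubicGauss.
Context {R : realType}.

Local Notation mu := (@lebesgue_measure R).

(** The condition on [y] describes a sector around the real axis in which
    [e^(i t z^3 - z^2)] decays like a Gaussian. *)
Lemma reE_le (t x y : R) : 0 <= t -> 0 <= y -> 3 * y ^+ 2 <= x ^+ 2 ->
  reE t x y <= - (2 / 3) * x ^+ 2.
Proof.
move=> t0 y0 yx; rewrite /reE.
have w0 : 0 <= t * y by exact: mulr_ge0.
have -> : t * y ^+ 3 = t * y * y ^+ 2 by ring.
have -> : 3 * t * x ^+ 2 * y = 3 * (t * y * x ^+ 2) by ring.
have h1 : t * y * (3 * y ^+ 2) <= t * y * x ^+ 2 by exact: ler_wpM2l.
have h2 : 0 <= t * y * x ^+ 2 by rewrite mulr_ge0// sqr_ge0.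
lra.
Qed.

Lemma Rintegral_cutoff (f : R -> R) (v : nat -> R) :
  mu.-integrable [set` `[0, +oo[] (EFin \o f) ->
  v n @[n --> \oo] --> +oo ->
  \int[mu]_(x in [set` `[0, v n]]) f x @[n --> \oo] -->
  \int[mu]_(x in [set` `[0, +oo[]) f x.
Proof.
move=> intf voo.
have E n : [set` `[0, v n]] = [set` `[0, +oo[] `&` [set` `]-oo, v n]] :> set R.
  apply/seteqP; split => x /=; rewrite !in_itv/= ?andbT.
    by move=> /andP[].
  by move=> [-> ->].
rewrite (_ : (fun n => _) =
    fun n => \int[mu]_(x in [set` `[0, +oo[]) ((f \_ [set` `]-oo, v n]]) x)); last first.
  by apply/funext => n; rewrite E Rintegral_mkcondr.
have mD : measurable ([set` `[0, +oo[] : set (measurableTypeR R)) by exact: measurable_itv.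
have mf := measurable_int _ intf.
have [] // := @dominated_convergence _ _ _ mu _ mD
  (fun n x => ((f \_ [set` `]-oo, v n]]) x)%:E) (EFin \o f) (abse \o (EFin \o f)).
- move=> n; apply/measurable_EFinP; apply/measurable_restrict => //.
  apply: (measurable_funS mD) => //.
  exact/measurable_EFinP.
- apply: aeW => x _; apply: cvg_near_cst.
  move/cvgryPge: voo => /(_ x); apply: filterS => n xv.
  by rewrite patchE mem_set//= in_itv.
- exact: integrable_abse.
- apply: aeW => x n _ /=; rewrite patchE; case: ifP => _ //=.
  by rewrite (_ : point = 0 :> R)// normr0 lee_fin.
- by move=> _ _ h; apply: fine_cvg; rewrite fineK//; exact: integrable_fin_num.
Qed.

Definition cubic_gauss (t x : R) := expR (- x ^+ 2) * cos (t * x ^+ 3).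

Lemma continuous_cubic_gauss t : continuous (cubic_gauss t).
Proof.
move=> x; have cx : continuous_at x (fun y : R => y) by exact: cvg_id.
by rewrite /cubic_gauss; continuity assumption.
Qed.

Lemma integrable_cubic_gauss t (D : set (measurableTypeR R)) : measurable D ->
  mu.-integrable D (EFin \o cubic_gauss t).
Proof.
move=> mD; have := integrableT_gauss (R := R).
move=> /(integrableS measurableT mD (@subsetT _ _)).
apply: le_integrable => //.
  apply/measurable_EFinP/measurable_funTS.
  by apply: continuous_measurable_fun; exact: continuous_cubic_gauss.
move=> x _ /=; rewrite lee_fin /cubic_gauss /gauss_fun normrM ler_piMr//.
by rewrite ler_norml cos_geN1 cos_le1.
Qed.

Variable t : R.
Hypothesis t0 : 0 < t.

Let k : R := (3 * t)^-1.
Let c : R := Num.sqrt 3 * k.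

Let kt : t * k = 3^-1.
Proof. by rewrite /k; field; rewrite gt_eqF. Qed.

Let k0 : 0 < k. Proof. by rewrite invr_gt0 mulr_gt0. Qed.
Let c0 : 0 < c. Proof. by rewrite mulr_gt0// sqrtr_gt0. Qed.
Let c2 : c ^+ 2 = 3 * k ^+ 2.
Proof. by rewrite exprMn sqr_sqrtr. Qed.

(** The curve [p + i q] is an arc of the hyperbola on which the exponent
    [i t z^3 - z^2] is real. *)
Let p (s : R) := c * sinh (s / 3).
Let q (s : R) := k * (cosh (s / 3) - 1).
Let p' (s : R) := c * cosh (s / 3) / 3.
Let q' (s : R) := k * sinh (s / 3) / 3.
Let z : R := 2 / (27 * t ^+ 2).

Lemma is_derive_path_re (s : R) : is_derive s 1 p (p' s).
Proof.
have D : is_derive s 1 (fun s : R => s / 3) 3^-1.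
  by apply: is_derive_eq; rewrite /GRing.scale/=; ring.
have D' : is_derive s 1 (fun s : R => sinh (s / 3)) (cosh (s / 3) * 3^-1).
  exact: (@is_derive1_comp R sinh (fun s : R => s / 3) s _ _ (is_derive_sinh _) D).
rewrite /p; apply: is_derive_eq; rewrite /p' /GRing.scale/=; ring.
Qed.

Lemma is_derive_path_im (s : R) : is_derive s 1 q (q' s).
Proof.
have D : is_derive s 1 (fun s : R => s / 3) 3^-1.
  by apply: is_derive_eq; rewrite /GRing.scale/=; ring.
have D' : is_derive s 1 (fun s : R => cosh (s / 3)) (sinh (s / 3) * 3^-1).
  exact: (@is_derive1_comp R cosh (fun s : R => s / 3) s _ _ (is_derive_cosh _) D).
rewrite /q; apply: is_derive_eq; rewrite /q' /GRing.scale/=; ring.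
Qed.

Lemma path_imE s : imE t (p s) (q s) = 0.
Proof.
rewrite /imE /p /q; set S := sinh _; set C := cosh _.
have S2 : S ^+ 2 = C ^+ 2 - 1 by exact: cosh2_sinh2.
have -> : t * (c * S) ^+ 3 = (c * S) * (t * k) * (3 * k) * S ^+ 2.
  have -> : (c * S) ^+ 3 = c * S * (c ^+ 2 * S ^+ 2) by ring.
  by rewrite c2; ring.
rewrite S2.
have -> : 3 * t * (c * S) * (k * (C - 1)) ^+ 2 = 3 * (c * S) * (t * k) * k * (C - 1) ^+ 2 by ring.
by rewrite kt; field.
Qed.

Lemma path_reE s : reE t (p s) (q s) = z - z * cosh s.
Proof.
have -> : cosh s = cosh (3 * (s / 3)) by congr cosh; field.
rewrite cosh_triple /reE /p /q; set S := sinh _; set C := cosh _.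
have S2 : S ^+ 2 = C ^+ 2 - 1 by exact: cosh2_sinh2.
have zk : z = 2 / 3 * k ^+ 2 by rewrite /z /k; field; rewrite gt_eqF.
have -> : (c * S) ^+ 2 = 3 * k ^+ 2 * (C ^+ 2 - 1) by rewrite exprMn c2 S2.
have -> : 3 * t * (3 * k ^+ 2 * (C ^+ 2 - 1)) * (k * (C - 1)) =
  9 * (t * k) * k ^+ 2 * (C ^+ 2 - 1) * (C - 1) by ring.
have -> : t * (k * (C - 1)) ^+ 3 = (t * k) * k ^+ 2 * (C - 1) ^+ 3 by ring.
by rewrite kt zk; field.
Qed.

Lemma path_re0 : p 0 = 0.
Proof. by rewrite /p mul0r sinh0 mulr0. Qed.

Lemma path_im0 : q 0 = 0.
Proof. by rewrite /q mul0r cosh0 subrr mulr0. Qed.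

Lemma path_re_lt (s u : R) : s < u -> p s < p u.
Proof. by move=> su; rewrite /p ltr_pM2l// sinh_lt// ltr_pM2r. Qed.

Lemma path_re_ge (s : R) : 0 <= s -> c / 6 * s <= p s.
Proof.
move=> s0; have := sinh_ge (divr_ge0 s0 (ler0n R 3)).
rewrite -(ler_pM2l c0) => /(le_trans _); apply.
by rewrite le_eqVlt; apply/orP; left; apply/eqP; field.
Qed.

Lemma path_im_ge0 s : 0 <= q s.
Proof. by rewrite /q mulr_ge0 ?(ltW k0)// subr_ge0 cosh_ge1. Qed.

Lemma path_im_le s : 3 * q s ^+ 2 <= p s ^+ 2.
Proof.
rewrite /p /q [(c * _) ^+ 2]exprMn [(k * _) ^+ 2]exprMn c2 cosh2_sinh2 mulrA.
rewrite ler_wpM2l ?mulr_ge0 ?sqr_ge0 ?(ltW k0)//.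
by have := cosh_ge1 (s / 3); set C := cosh _; nra.
Qed.

(** The Gaussian decay [e^(- (2/3) p^2)] enters through [e^(- u) u <= 1]. *)
Lemma flux_le (l s : R) : 0 <= l <= 1 -> 0 < s ->
  `|flux t p q l s| <= 3 / 2 / p s.
Proof.
move=> /andP[l0 l1] s0.
have ps0 : 0 < p s by rewrite -path_re0 path_re_lt.
have q0 := path_im_ge0 s; have qp := path_im_le s.
have lq0 : 0 <= l * q s by exact: mulr_ge0.
have lqp : 3 * (l * q s) ^+ 2 <= p s ^+ 2.
  apply: le_trans qp; rewrite ler_pM2l// exprMn ler_piMl ?sqr_ge0//.
  by rewrite exprn_ile1.
have := reE_le (ltW t0) lq0 lqp; rewrite -ler_expR => bound.
have qlep : q s <= p s.
  by rewrite -ler_sqr ?nnegrE ?(ltW ps0)//; have := sqr_ge0 (q s); lra.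
rewrite /flux normrN normrM [`|expR _ * _|]normrM (ger0_norm (expR_ge0 _)) (ger0_norm q0).
apply: (@le_trans _ _ (expR (- (2 / 3) * p s ^+ 2) * 1 * p s)).
  apply: ler_pM => //; apply: ler_pM => //.
  by rewrite ler_norml sin_geN1 sin_le1.
rewrite mulr1 ler_pdivlMr//.
have := expR_ge1Dx (2 / 3 * p s ^+ 2); have := expRKN (2 / 3 * p s ^+ 2).
rewrite mulNr; move: (expR (2 / 3 * p s ^+ 2)) (expR_gt0 (- (2 / 3 * p s ^+ 2))).
move: (expR (- (2 / 3 * p s ^+ 2))) (p s) => e P a e0 ae aP.
nra.
Qed.

Let J (l : R) (n : nat) : R :=
  \int[mu]_(s in [set` `[0, n.+1%:R]]) integrand t p q p' q' l s.

Let Cp' : continuous p'.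
Proof.
move=> s; have cs : continuous_at s (fun y : R => y) by exact: cvg_id.
have ch : continuous (@cosh R) by exact: is_derive_continuous (@is_derive_cosh R).
rewrite /p'; apply: conM; last exact: conC.
apply: conM; first exact: conC.
by apply: (@concomp _ _ cosh) => //; apply: conM => //; exact: conC.
Qed.

Let Cq' : continuous q'.
Proof.
move=> s; have cs : continuous_at s (fun y : R => y) by exact: cvg_id.
have ch : continuous (@sinh R) by exact: is_derive_continuous (@is_derive_sinh R).
rewrite /q'; apply: conM; last exact: conC.
apply: conM; first exact: conC.
by apply: (@concomp _ _ sinh) => //; apply: conM => //; exact: conC.
Qed.

Lemma path_re_cvg : p n.+1%:R @[n --> \oo] --> +oo.
Proof.
apply/cvgryPge => A; exists (Num.truncn (A / (c / 6))) => // n /= An.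
have c6 : 0 < c / 6 by rewrite divr_gt0.
apply: le_trans (path_re_ge (ler0n _ _)).
rewrite -ler_pdivrMl// mulrC; apply: ltW.
by rewrite -truncn_le_nat.
Qed.

(** The end points of the two curves over [[0, n + 1]] differ, but the flux
    through the arc joining them tends to [0]. *)
Lemma homotopy_cvg : J 1 n - J 0 n @[n --> \oo] --> 0.
Proof.
apply/norm_cvg0P.
apply: (@squeeze_cvgr _ _ _ _ (fun=> 0) (fun n => 3 / 2 / p n.+1%:R)).
- apply: nearW => n; rewrite normr_ge0 /=.
  have [d /andP[d0 d1] ->] := homotopy_difference t is_derive_path_re
    is_derive_path_im Cp' Cq' (ltr0Sn R n) path_im0.
  by apply: flux_le => //; rewrite !ltW.
- exact: cvg_cst.
- rewrite -[X in _ --> X](mulr0 (3 / 2)); apply: cvgMl_tmp.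
  apply/gtr0_cvgV0; last exact: path_re_cvg.
  by apply: nearW => n; rewrite -path_re0 path_re_lt.
Qed.

(** At [l = 0] the curve is the real axis, run through at speed [p']. *)
Lemma homotopy0 n :
  J 0 n = \int[mu]_(x in [set` `[0, p n.+1%:R]]) cubic_gauss t x.
Proof.
have dp : (p^`())%classic = p'.
  by apply/funext => s; rewrite derive1E; have [_] := is_derive_path_re s.
have cp : continuous p by exact: is_derive_continuous is_derive_path_re.
transitivity (\int[mu]_(x in [set` `[p 0, p n.+1%:R]]) cubic_gauss t x); last first.
  by rewrite path_re0.
rewrite /J /Rintegral; congr fine.
rewrite integration_by_substitution_increasing//.
- apply: eq_integral => s _; rewrite dp /integrand /cubic_gauss/= !mul0r.
  rewrite mulr0 subr0 /reE /imE !expr0n/= !mulr0 !addr0 !subr0 mulrA//.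
- by move=> s u _ _; exact: path_re_lt.
- by move=> s _; rewrite dp; exact: Cp'.
- by rewrite dp; apply/cvg_ex; exists (p' 0); apply: cvg_at_right_filter; exact: Cp'.
- by rewrite dp; apply/cvg_ex; exists (p' n.+1%:R); apply: cvg_at_left_filter; exact: Cp'.
- split.
  + by move=> s _; have [] := is_derive_path_re s.
  + by apply: cvg_at_right_filter; exact: cp.
  + by apply: cvg_at_left_filter; exact: cp.
- by apply: continuous_subspaceT; exact: continuous_cubic_gauss.
Qed.

Lemma integrand1E s :
  integrand t p q p' q' 1 s = c / 3 * expR z * (expR (- z * cosh s) * cosh (1 / 3 * s)).
Proof.
rewrite /integrand !mul1r path_imE path_reE cos0 sin0 mul0r subr0 mul1r expRD /p'.
by rewrite mulNr (mulrC (3^-1) s); ring.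
Qed.

(** The cut-off integrals along the two ends of the homotopy have the same limit;
    on the final curve the integrand is nonnegative, so that the limit of the
    cut-off integrals is the integral over the whole half-line. *)
Lemma cubic_gauss_besselK :
  \int[mu]_(x in [set` `[0, +oo[]) cubic_gauss t x = c / 3 * expR z * besselK (1 / 3) z.
Proof.
set L := LHS.
have JL : J 1 n @[n --> \oo] --> L.
  have J0L : J 0 n @[n --> \oo] --> L.
    under eq_fun do rewrite homotopy0.
    by apply: Rintegral_cutoff path_re_cvg; exact: integrable_cubic_gauss.
  rewrite (_ : J 1 = (fun n => J 1 n - J 0 n) \+ J 0).
    by rewrite -[L]add0r; apply: cvgD => //; exact: homotopy_cvg.
  by apply/funext => n /=; rewrite subrK.
set h := fun s => expR (- z * cosh s) * cosh (1 / 3 * s).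
set C := c / 3 * expR z in JL *.
have C0 : 0 < C by rewrite mulr_gt0 ?expR_gt0// divr_gt0.
have h0 s : 0 <= h s.
  by rewrite mulr_ge0 ?expR_ge0// (le_trans ler01)// cosh_ge1.
have ch : continuous h.
  have cc : continuous (@cosh R) by exact: is_derive_continuous (@is_derive_cosh R).
  move=> s; have cs : continuous_at s (fun y : R => y) by exact: cvg_id.
  have c1 : continuous_at s (fun y : R => cosh y) by exact: concomp.
  have c2' : continuous_at s (fun y : R => cosh (1 / 3 * y)).
    by apply: concomp => //; apply: conM => //; exact: conC.
  by rewrite /h; continuity assumption.
have mh : measurable_fun [set: R] h by exact: continuous_measurable_fun.
have KE : (C%:E * \int[mu]_(s in [set` `[0%R, +oo[]) (h s)%:E = L%:E)%E.
  rewrite -ge0_integralZl_EFin//; first last.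
  - exact: ltW.
  - by apply/measurable_EFinP/measurable_funTS.
  - by move=> s _; rewrite lee_fin.
  have := @ge0_cvgn_integral R mu (fun s => C * h s)%R.
  move=> /(_ (fun s => mulr_ge0 (ltW C0) (h0 s))).
  have mCh : measurable_fun [set: R] (fun s => C * h s) by exact: measurable_funM.
  move=> /(_ mCh); rewrite -cvg_shiftS => lim1.
  under eq_integral do rewrite -EFinM.
  apply: cvg_unique lim1 _ => //.
  rewrite (_ : (fun n => _) = EFin \o J 1).
    by apply: cvg_EFin; [exact: nearW|exact: JL].
  apply/funext => n; rewrite /J /= /Rintegral fineK.
    by apply: eq_integral => s _; rewrite integrand1E.
  apply: integrable_fin_num => //.
  exact: (integrable_integrand t is_derive_path_re is_derive_path_im Cp' Cq').
rewrite /besselK -/h /Rintegral.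
have -> : (\int[mu]_(s in [set` `[0%R, +oo[]) (h s)%:E = (C^-1 * L)%:E)%E.
  by rewrite EFinM -KE muleA -EFinM mulVf ?gt_eqF// mul1e.
by rewrite /= mulVKf// gt_eqF.
Qed.

End CubicGauss.

(** * The Gaussian state *)

Section GaussianState.
Context {R : realType}.

Local Notation mu := (@lebesgue_measure R).

Lemma Rintegral_gauss : \int[mu]_x (gauss_fun x) = Num.sqrt pi.
Proof. by rewrite /Rintegral integralT_gauss. Qed.

Lemma Rintegral_gauss_half :
  \int[mu]_(x in [set` `[0, +oo[]) (gauss_fun x) = Num.sqrt pi / 2.
Proof. by rewrite /Rintegral integral0y_gauss. Qed.

Lemma integrable_gauss (D : set (measurableTypeR R)) : measurable D ->
  mu.-integrable D (EFin \o @gauss_fun R).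
Proof. by move=> mD; exact: integrableS integrableT_gauss. Qed.

(** The reflection of integrals is available for nonnegative functions, hence the
    added Gaussian. *)
Lemma Rintegral_cubic_gauss (t : R) :
  \int[mu]_x cubic_gauss t x =
  2 * \int[mu]_(x in [set` `[0, +oo[]) cubic_gauss t x.
Proof.
pose g x := gauss_fun x + cubic_gauss t x.
have ic D : measurable D -> mu.-integrable D (EFin \o cubic_gauss t).
  exact: integrable_cubic_gauss.
have mH : measurable ([set` `[0, +oo[] : set (measurableTypeR R)) by exact: measurable_itv.
have g0 x : 0 <= g x.
  rewrite /g /gauss_fun /cubic_gauss -[X in X + _]mulr1 -mulrDr.
  by rewrite mulr_ge0 ?expR_ge0//; have := cos_geN1 (t * x ^+ 3); lra.
have cg : continuous g.
  move=> x; apply: conD; first exact: continuous_gauss_fun.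
  exact: continuous_cubic_gauss.
have eg : g =1 g \o -%R.
  move=> x; rewrite /g /gauss_fun /cubic_gauss /= sqrrN.
  by rewrite (_ : t * (- x) ^+ 3 = - (t * x ^+ 3)) ?cosN//; ring.
have := ge0_symfun_integralT g0 cg eg.
rewrite (_ : [set x | _] = [set` `[0, +oo[]); last first.
  by apply/seteqP; split => x/=; rewrite in_itv/= andbT.
have ig D : measurable D -> mu.-integrable D (EFin \o g).
  move=> mD; rewrite (_ : EFin \o g = (EFin \o gauss_fun) \+ (EFin \o cubic_gauss t))%E.
    by apply: integrableD => //; [exact: integrable_gauss|exact: ic].
  by apply/funext => x; rewrite /= -EFinD.
move=> /(congr1 fine); rewrite fineM//; last exact: integrable_fin_num (ig _ mH).
rewrite -[LHS]/(\int[mu]_x g x) -[X in _ * X]/(\int[mu]_(x in [set` `[0, +oo[]) g x).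
rewrite !RintegralD//; [|exact: integrable_gauss|exact: ic|exact: integrable_gauss|exact: ic].
by rewrite Rintegral_gauss Rintegral_gauss_half /=; lra.
Qed.

Definition cubic_gauss_odd (t x : R) := expR (- x ^+ 2) * sin (t * x ^+ 3).

Lemma continuous_cubic_gauss_odd t : continuous (cubic_gauss_odd t).
Proof.
move=> x; have cx : continuous_at x (fun y : R => y) by exact: cvg_id.
by rewrite /cubic_gauss_odd; continuity assumption.
Qed.

Lemma integrable_cubic_gauss_odd t :
  mu.-integrable [set: measurableTypeR R] (EFin \o cubic_gauss_odd t).
Proof.
have := integrableT_gauss (R := R).
apply: le_integrable => //.
  apply/measurable_EFinP/measurable_funTS.
  by apply: continuous_measurable_fun; exact: continuous_cubic_gauss_odd.
move=> x _ /=; rewrite lee_fin /cubic_gauss_odd /gauss_fun normrM ler_piMr//.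
by rewrite ler_norml sin_geN1 sin_le1.
Qed.

Lemma ge0_integral_opp (f : R -> \bar R) : measurable_fun [set: measurableTypeR R] f ->
  (forall x, (0 <= f x)%E) -> (\int[mu]_x f (- x)%R = \int[mu]_x f x)%E.
Proof.
move=> mf f0; have := @ge0_integral_pushforward _ _ (measurableTypeR R)
  (measurableTypeR R) R -%R _ mu [set: R] f.
rewrite preimage_setT => <-//.
by apply: eq_measure_integral => //= A mA _; exact: lebesgue_measureN.
Qed.

Lemma Rintegral_cubic_gauss_odd (t : R) : \int[mu]_x cubic_gauss_odd t x = 0.
Proof.
have ig := integrable_gauss measurableT; have io := integrable_cubic_gauss_odd t.
pose g x := gauss_fun x + cubic_gauss_odd t x.
have g0 x : 0 <= g x.
  rewrite /g /gauss_fun /cubic_gauss_odd -[X in X + _]mulr1 -mulrDr.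
  by rewrite mulr_ge0 ?expR_ge0//; have := sin_geN1 (t * x ^+ 3); lra.
have cg : continuous g.
  move=> x; apply: conD; first exact: continuous_gauss_fun.
  exact: continuous_cubic_gauss_odd.
have gN x : g (- x) = gauss_fun x - cubic_gauss_odd t x.
  rewrite /g /gauss_fun /cubic_gauss_odd sqrrN.
  by rewrite (_ : t * (- x) ^+ 3 = - (t * x ^+ 3)) ?sinN ?mulrN//; ring.
have mg : measurable_fun [set: measurableTypeR R] (EFin \o g).
  by apply/measurable_EFinP; exact: continuous_measurable_fun.
have := ge0_integral_opp mg (fun x => g0 x) => /(congr1 fine) /=.
rewrite -[LHS]/(\int[mu]_x g (- x)) -[RHS]/(\int[mu]_x g x).
under eq_Rintegral do rewrite gN.
rewrite RintegralB// RintegralD//; lra.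
Qed.

Lemma Phi2E (x : R) : (pi `^ (- 4^-1) * expR (- (x ^+ 2) / 2)) ^+ 2 =
  (Num.sqrt pi)^-1 * gauss_fun x.
Proof.
rewrite exprMn /gauss_fun; congr (_ * _).
- rewrite -powR_mulrn ?powR_ge0// -powRrM (_ : - 4^-1 * 2%:R = - 2^-1 :> R); last by field.
  by rewrite powRN powR12_sqrt// pi_ge0.
- by rewrite -expRM_natl; congr expR; field.
Qed.

Lemma sqmodulus_Phi (x : R) : sqmodulus (Phi x) = (Num.sqrt pi)^-1 * gauss_fun x.
Proof. by rewrite -Phi2E /sqmodulus /Phi /= expr0n addr0. Qed.

Lemma cmeasurable_Phi : cmeasurable (@Phi R).
Proof.
apply: cmeasurable_real; apply: continuous_measurable_fun => x.
have cx : continuous_at x (fun y : R => y) by exact: cvg_id.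
by continuity assumption.
Qed.

Lemma L2_modulus_Phi (f : R -> R[i]) : cmeasurable f ->
  (forall x, sqmodulus (f x) = sqmodulus (Phi x)) -> L2 f.
Proof.
move=> mf fE; apply: (@L2_le _ (fun x => (Num.sqrt pi)^-1 * gauss_fun x)) => //.
  have := integrableZl measurableT (Num.sqrt pi)^-1 (integrable_gauss measurableT).
  by apply: eq_integrable => // x _; rewrite /= EFinM.
by move=> x; rewrite fE sqmodulus_Phi.
Qed.

Lemma L2_Phi : L2 (@Phi R).
Proof. exact: L2_modulus_Phi cmeasurable_Phi (fun _ => erefl). Qed.

Lemma inner_Phi_expi (t : R) :
  inner Phi (fun x => expi (t * x ^+ 3) * Phi x) =
  ((Num.sqrt pi)^-1 * \int[mu]_x cubic_gauss t x)%:C.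
Proof.
rewrite /inner /cintegral -[X in X +i* _]/(\int[mu]_x _) -[X in _ +i* X]/(\int[mu]_x _).
have E x : conjc (Phi x) * (expi (t * x ^+ 3) * Phi x) =
    ((Num.sqrt pi)^-1 * cubic_gauss t x) +i* ((Num.sqrt pi)^-1 * cubic_gauss_odd t x).
  rewrite /cubic_gauss /cubic_gauss_odd -/(gauss_fun x) !mulrA -!Phi2E.
  by rewrite /Phi /expi; apply/eqP; rewrite eq_complex /=; apply/andP; split; apply/eqP; ring.
under eq_Rintegral do rewrite E /=.
under [X in _ +i* X]eq_Rintegral do rewrite E /=.
rewrite !RintegralZl//; [|exact: integrable_cubic_gauss_odd|exact: integrable_cubic_gauss].
by rewrite Rintegral_cubic_gauss_odd mulr0.
Qed.

Lemma cubic_gauss_norm (t : R) : cubic_gauss `|t| = cubic_gauss t.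
Proof.
apply/funext => x; rewrite /cubic_gauss; have [//|t0] := ger0P t.
by rewrite mulNr cosN.
Qed.

End GaussianState.

Unset Implicit Arguments.

Theorem theorem2p1 (R : realType) (t : R) :
  (exists U : operator R,
     is_functional_calculus (position R) (fun x => expi (t * x ^+ 3)) U) /\
  (forall U : operator R,
     is_functional_calculus (position R) (fun x => expi (t * x ^+ 3)) U ->
     inner Phi (U Phi) =
       if t == 0 then 1
       else (2 / (3 * `|t| * Num.sqrt (3 * pi)) * expR (2 / (27 * t ^+ 2))
             * besselK (1 / 3) (2 / (27 * t ^+ 2)))%:C).
Proof.
have mt : measurable_fun [set: measurableTypeR R] (fun x : R => t * x ^+ 3).
  by apply: measurable_funM => //; exact: measurable_funX.
split; first exact: position_functional_calculus_exists.
move=> U hU.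
have mphi := cmeasurable_expi mt.
have Lphi : L2 (fun x : R => expi (t * x ^+ 3) * Phi x).
  apply: L2_modulus_Phi; first by apply: cmeasurableM => //; exact: cmeasurable_Phi.
  by move=> x; rewrite sqmodulusM sqmodulus_expi mul1r.
rewrite (position_functional_calculus mphi hU L2_Phi Lphi) inner_Phi_expi.
have [->|t0] := eqVneq t 0.
  rewrite (_ : cubic_gauss 0 = gauss_fun) ?Rintegral_gauss.
    by rewrite mulVf// sqrtr_eq0 -ltNge pi_gt0.
  by apply/funext => x; rewrite /cubic_gauss mul0r cos0 mulr1.
have nt0 : 0 < `|t| by rewrite normr_gt0.
congr (_%:C); rewrite -cubic_gauss_norm Rintegral_cubic_gauss cubic_gauss_besselK//.
rewrite real_normK ?num_real// sqrtrM//.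
have s3 : Num.sqrt 3 ^+ 2 = 3 :> R by rewrite sqr_sqrtr.
have s30 : Num.sqrt 3 != 0 :> R by rewrite sqrtr_eq0 -ltNge.
have sp0 : Num.sqrt pi != 0 :> R by rewrite sqrtr_eq0 -ltNge pi_gt0.
rewrite !mulrA; congr (_ * _ * _).
transitivity (2 * Num.sqrt 3 ^+ 2 / (9 * `|t| * Num.sqrt 3 * Num.sqrt pi)).
  by field; rewrite sp0 s30 gt_eqF.
by rewrite s3; field; rewrite sp0 s30 gt_eqF.
Qed.
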